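(* Assume that $\mathbb{F}$ is algebraically closed and $q$ is not a root of unity. Let $d\geq0$ be an even integer. Let $\mathbf{OM}_d$ denote the set of all isomorphism classes of irreducible $\mathfrak{H}_q$-modules of dimension $d+1$. Let $\mathbf{OP}_d$ denote the set of all quadruples $(k_0,k_1,k_2,k_3)$ of nonzero scalars in $\mathbb{F}$ that satisfy $k_0k_1k_2k_3=q^{-d-1}$ and $$k_0^2,k_1^2,k_2^2,k_3^2\neq q^{-i}\qquad\text{for all } i=2,4,\ldots,d.$$ Then there exists a bijection $\mathcal{O}:\mathbf{OP}_d\to\mathbf{OM}_d$ given by $$(k_0,k_1,k_2,k_3)\mapsto\text{the isomorphism class of } O(k_0,k_1,k_2,k_3)$$ for all $(k_0,k_1,k_2,k_3)\in\mathbf{OP}_d$.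
   Context: $\mathbb{F}$ is a field and $q\in\mathbb{F}$ is nonzero. The universal DAHA $\mathfrak{H}_q$ of type $(C_1^\vee,C_1)$ is the unital associative $\mathbb{F}$-algebra with generators $t_0^{\pm1},t_1^{\pm1},t_2^{\pm1},t_3^{\pm1}$ and relations: $t_it_i^{-1}=t_i^{-1}t_i=1$ for all $i$; $t_i+t_i^{-1}$ is central for all $i$; $t_0t_1t_2t_3=q^{-1}$. For an even integer $d\ge0$ and nonzero $k_0,k_1,k_2,k_3\in\mathbb{F}$ with $k_0k_1k_2k_3=q^{-d-1}$, $O(k_0,k_1,k_2,k_3)$ denotes the $(d+1)$-dimensional $\mathfrak{H}_q$-module with $\mathbb{F}$-basis $\{v_i\}_{i=0}^d$ and action - $t_0v_i=k_0^{-1}q^{-i}(1-q^i)(1-k_0^2q^i)v_{i-1}+(k_0+k_0^{-1}-k_0^{-1}q^{-i})v_i$ for $i=2,4,\ldots,d$; $t_0v_i=k_0^{-1}q^{-i-1}(v_i-v_{i+1})$ for $i=1,3,\ldots,d-1$; $t_0v_0=k_0v_0$; - $t_1v_i=-k_1(1-q^i)(1-k_0^2q^i)v_{i-1}+k_1v_i+k_1^{-1}v_{i+1}$ for $i=2,4,\ldots,d-2$; $t_1v_i=k_1^{-1}v_i$ for $i=1,3,\ldots,d-1$; $t_1v_0=k_1v_0+k_1^{-1}v_1$; $t_1v_d=-k_1(1-q^d)(1-k_0^2q^d)v_{d-1}+k_1v_d$; - $t_2v_i=k_2q^{d-i}(v_i-v_{i+1})$ for $i=0,2,\ldots,d-2$;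 $t_2v_i=-k_2(1-k_2^{-2}q^{i-d-1})(1-q^{d-i+1})v_{i-1}+(k_2+k_2^{-1}-k_2q^{d-i+1})v_i$ for $i=1,3,\ldots,d-1$; $t_2v_d=k_2v_d$; - $t_3v_i=k_3v_i$ for $i=0,2,\ldots,d$; $t_3v_i=-k_3^{-1}(1-k_2^{-2}q^{i-d-1})(1-q^{i-d-1})v_{i-1}+k_3^{-1}v_i+k_3v_{i+1}$ for $i=1,3,\ldots,d-1$. (When $d=0$ read $v_{-1}=v_1=0$, so $t_iv_0=k_iv_0$ for all $i$. These formulas do define an $\mathfrak{H}_q$-module.) *)

(* Defs.v *)
From HB Require Import structures.
From mathcomp Require Import all_boot all_order all_algebra.
From mathcomp Require Import boolp.
From mathcomp Require Import ring.

Set Implicit Arguments.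
Unset Strict Implicit.
Unset Printing Implicit Defensive.

Import GRing.Theory.
Local Open Scope ring_scope.
Local Open Scope quotient_scope.

Notation ix0 := (@Ordinal 4 0 isT).
Notation ix1 := (@Ordinal 4 1 isT).
Notation ix2 := (@Ordinal 4 2 isT).
Notation ix3 := (@Ordinal 4 3 isT).

Section DahaTerms.
Variable F : fieldType.

(* [Dgen i] stands for t_i and [Dinv i] for t_i^{-1}. *)
Inductive daha_term : Type :=
| Dscal of F
| Dgen of 'I_4
| Dinv of 'I_4
| Dadd of daha_term & daha_term
| Dmul of daha_term & daha_term.

HB.instance Definition _ := gen_eqMixin daha_term.
HB.instance Definition _ := gen_choiceMixin daha_term.

(* The least congruence making the quotient a unital associative F-algebra
   in which the defining relations hold. *)
Inductive daha_cong (q : F) : daha_term -> daha_term -> Prop :=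
| Drefl x : daha_cong q x x
| Dsym x y : daha_cong q x y -> daha_cong q y x
| Dtrans x y z : daha_cong q x y -> daha_cong q y z -> daha_cong q x z
| Dadd_cong x x' y y' : daha_cong q x x' -> daha_cong q y y' ->
    daha_cong q (Dadd x y) (Dadd x' y')
| Dmul_cong x x' y y' : daha_cong q x x' -> daha_cong q y y' ->
    daha_cong q (Dmul x y) (Dmul x' y')
| DaddA x y z : daha_cong q (Dadd x (Dadd y z)) (Dadd (Dadd x y) z)
| DaddC x y : daha_cong q (Dadd x y) (Dadd y x)
| Dadd0 x : daha_cong q (Dadd (Dscal 0) x) x
| DaddN x : daha_cong q (Dadd (Dmul (Dscal (-1)) x) x) (Dscal 0)
| DmulA x y z : daha_cong q (Dmul x (Dmul y z)) (Dmul (Dmul x y) z)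
| Dmul1 x : daha_cong q (Dmul (Dscal 1) x) x
| DmulDl x y z : daha_cong q (Dmul (Dadd x y) z) (Dadd (Dmul x z) (Dmul y z))
| DmulDr x y z : daha_cong q (Dmul x (Dadd y z)) (Dadd (Dmul x y) (Dmul x z))
| DscalD a b : daha_cong q (Dadd (Dscal a) (Dscal b)) (Dscal (a + b))
| DscalM a b : daha_cong q (Dmul (Dscal a) (Dscal b)) (Dscal (a * b))
| DscalC a x : daha_cong q (Dmul (Dscal a) x) (Dmul x (Dscal a))
| DgenV i : daha_cong q (Dmul (Dgen i) (Dinv i)) (Dscal 1)
| DVgen i : daha_cong q (Dmul (Dinv i) (Dgen i)) (Dscal 1)
| Dcentral i x : daha_cong q (Dmul (Dadd (Dgen i) (Dinv i)) x)
                             (Dmul x (Dadd (Dgen i) (Dinv i)))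
| Dprod : daha_cong q
    (Dmul (Dmul (Dmul (Dgen ix0) (Dgen ix1)) (Dgen ix2)) (Dgen ix3))
    (Dscal q^-1).

Definition daha_congb (q : F) : rel daha_term :=
  fun x y => `[< daha_cong q x y >].

Lemma daha_congb_equiv (q : F) : equiv_class_of (daha_congb q).
Proof.
split=> [x|x y|y x z].
- exact/asboolP/Drefl.
- by apply/asboolP/asboolP; exact: Dsym.
- by move=> /asboolP xy /asboolP yz; apply/asboolP; exact: Dtrans xy yz.
Qed.

Canonical daha_equiv (q : F) := EquivRelPack (daha_congb_equiv q).

End DahaTerms.

Section DahaRelations.
Variables (F : fieldType) (q : F).

(* Commuting with every [t j] is centrality of [t i + t' i] in the subalgebra
   generated by the [t j] and [t' j], see [daha_eval_cong]. *)
Record daha_rel (A : algType F) (t t' : 'I_4 -> A) : Prop := DahaRel {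
  daha_relV : forall i, t i * t' i = 1;
  daha_relVl : forall i, t' i * t i = 1;
  daha_relC : forall i j, (t i + t' i) * t j = t j * (t i + t' i);
  daha_relP : t ix0 * t ix1 * t ix2 * t ix3 = q^-1%:A }.

Fixpoint daha_eval (A : algType F) (t t' : 'I_4 -> A) (x : daha_term F) : A :=
  match x with
  | Dscal a => a%:A
  | Dgen i => t i
  | Dinv i => t' i
  | Dadd x y => daha_eval t t' x + daha_eval t t' y
  | Dmul x y => daha_eval t t' x * daha_eval t t' y
  end.

Lemma daha_eval_cong (A : algType F) (t t' : 'I_4 -> A) : daha_rel t t' ->
  forall x y, daha_cong q x y -> daha_eval t t' x = daha_eval t t' y.
Proof.
case=> tV Vt tC tP x y; elim=> {x y} //=.
- by move=> x y z _ -> _ ->.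
- by move=> x x' y y' _ -> _ ->.
- by move=> x x' y y' _ -> _ ->.
- by move=> x y z; rewrite addrA.
- by move=> x y; rewrite addrC.
- by move=> x; rewrite scale0r add0r.
- by move=> x; rewrite -scalerAl mul1r scaleN1r addNr scale0r.
- by move=> x y z; rewrite mulrA.
- by move=> x; rewrite scale1r mul1r.
- by move=> x y z; rewrite mulrDl.
- by move=> x y z; rewrite mulrDr.
- by move=> a b; rewrite scalerDl.
- by move=> a b; rewrite -scalerAl mul1r scalerA.
- by move=> a x; rewrite -scalerAl -scalerAr mul1r mulr1.
- by move=> i; rewrite tV scale1r.
- by move=> i; rewrite Vt scale1r.
- move=> i; elim=> [a|j|j|x IHx y IHy|x IHx y IHy] /=.
  + by rewrite -scalerAl -scalerAr mul1r mulr1.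
  + exact: tC.
  + by rewrite -[LHS]mul1r -(Vt j) -mulrA (mulrA (t j)) -tC
             -(mulrA _ (t j)) tV mulr1.
  + by rewrite mulrDr [RHS]mulrDl IHx IHy.
  + by rewrite mulrA IHx -mulrA IHy mulrA.
Qed.

End DahaRelations.

Definition daha (F : fieldType) (q : F) (q_neq0 : q != 0) : Type :=
  {eq_quot (daha_equiv q)}.

Section DahaAlgebra.
Variables (F : fieldType) (q : F) (q_neq0 : q != 0).
Local Notation H := (daha q_neq0).

HB.instance Definition _ := Choice.copy H {eq_quot (daha_equiv q)}.

Definition daha_pi (x : daha_term F) : H := \pi_{eq_quot (daha_equiv q)} x.
Definition daha_repr (h : H) : daha_term F :=
  repr (h : {eq_quot (daha_equiv q)}).

Lemma daha_reprK h : daha_pi (daha_repr h) = h.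
Proof. exact: (@reprK _ {eq_quot (daha_equiv q)}). Qed.

Lemma daha_piP x y : daha_pi x = daha_pi y <-> daha_cong q x y.
Proof.
split=> [/(@eqmodP _ (daha_equiv q))/asboolP //|xy].
by apply/(@eqmodP _ (daha_equiv q))/asboolP.
Qed.

Lemma daha_repr_pi x : daha_cong q (daha_repr (daha_pi x)) x.
Proof. by apply/daha_piP; rewrite daha_reprK. Qed.

Definition daha_add (x y : H) : H := daha_pi (Dadd (daha_repr x) (daha_repr y)).
Definition daha_mul (x y : H) : H := daha_pi (Dmul (daha_repr x) (daha_repr y)).
Definition daha_opp (x : H) : H := daha_pi (Dmul (Dscal (-1)) (daha_repr x)).
Definition daha_scale (a : F) (x : H) : H :=
  daha_pi (Dmul (Dscal a) (daha_repr x)).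

Lemma daha_piD x y : daha_add (daha_pi x) (daha_pi y) = daha_pi (Dadd x y).
Proof. by apply/daha_piP; apply: Dadd_cong; apply: daha_repr_pi. Qed.
Lemma daha_piM x y : daha_mul (daha_pi x) (daha_pi y) = daha_pi (Dmul x y).
Proof. by apply/daha_piP; apply: Dmul_cong; apply: daha_repr_pi. Qed.
Lemma daha_piZ a x : daha_scale a (daha_pi x) = daha_pi (Dmul (Dscal a) x).
Proof.
by apply/daha_piP; apply: Dmul_cong; [apply: Drefl|apply: daha_repr_pi].
Qed.
Lemma daha_piN x : daha_opp (daha_pi x) = daha_pi (Dmul (Dscal (-1)) x).
Proof. exact: daha_piZ. Qed.

Lemma daha_ind (P : H -> Prop) : (forall x, P (daha_pi x)) -> forall h, P h.
Proof. by move=> Ppi h; rewrite -(daha_reprK h). Qed.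

Fact daha_addA : associative daha_add.
Proof.
elim/daha_ind=> x; elim/daha_ind=> y; elim/daha_ind=> z.
by rewrite !daha_piD; apply/daha_piP/DaddA.
Qed.
Fact daha_addC : commutative daha_add.
Proof.
elim/daha_ind=> x; elim/daha_ind=> y; rewrite !daha_piD.
exact/daha_piP/DaddC.
Qed.
Fact daha_add0 : left_id (daha_pi (Dscal 0)) daha_add.
Proof. by elim/daha_ind=> x; rewrite !daha_piD; apply/daha_piP/Dadd0. Qed.
Fact daha_mulA : associative daha_mul.
Proof.
elim/daha_ind=> x; elim/daha_ind=> y; elim/daha_ind=> z.
by rewrite !daha_piM; apply/daha_piP/DmulA.
Qed.
Fact daha_mul1l : left_id (daha_pi (Dscal 1)) daha_mul.
Proof. by elim/daha_ind=> x; rewrite !daha_piM; apply/daha_piP/Dmul1. Qed.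
Fact daha_mul1r : right_id (daha_pi (Dscal 1)) daha_mul.
Proof.
elim/daha_ind=> x; rewrite !daha_piM; apply/daha_piP.
exact: Dtrans (Dsym (DscalC _ _ _)) (Dmul1 _ _).
Qed.
Fact daha_mulDl : left_distributive daha_mul daha_add.
Proof.
elim/daha_ind=> x; elim/daha_ind=> y; elim/daha_ind=> z.
by rewrite !(daha_piM, daha_piD); apply/daha_piP/DmulDl.
Qed.
Fact daha_mulDr : right_distributive daha_mul daha_add.
Proof.
elim/daha_ind=> x; elim/daha_ind=> y; elim/daha_ind=> z.
by rewrite !(daha_piM, daha_piD); apply/daha_piP/DmulDr.
Qed.
Fact daha_scaleE a x : daha_scale a x = daha_mul (daha_pi (Dscal a)) x.
Proof. by elim/daha_ind: x => x; rewrite daha_piZ daha_piM. Qed.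
Fact daha_scalD a b :
  daha_add (daha_pi (Dscal a)) (daha_pi (Dscal b)) = daha_pi (Dscal (a + b)).
Proof. by rewrite daha_piD; apply/daha_piP/DscalD. Qed.
Fact daha_addN : left_inverse (daha_pi (Dscal 0)) daha_opp daha_add.
Proof.
by elim/daha_ind=> x; rewrite daha_piN daha_piD; apply/daha_piP/DaddN.
Qed.

HB.instance Definition _ :=
  GRing.isZmodule.Build H daha_addA daha_addC daha_add0 daha_addN.

(* 1 != 0: the one-dimensional representation t_0 = q^{-1},
   t_1 = t_2 = t_3 = 1 separates them. *)
Fact daha_one_neq0 : daha_pi (Dscal 1) != 0.
Proof.
pose t (i : 'I_4) : F^o := if i == ix0 then q^-1 else 1.
have tn0 i : t i != 0 by rewrite /t; case: ifP; rewrite ?invr_eq0 ?oner_eq0.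
have rel : daha_rel (F := F) q (A := F^o) t (fun i => (t i)^-1).
  split=> [i|i|i j|]; rewrite ?mulfV ?mulVf //; first by rewrite mulrC.
  by rewrite /t /= !mulr1 [RHS]mulr1.
apply/eqP => /daha_piP/(daha_eval_cong rel) /= /eqP.
by rewrite scale1r scale0r oner_eq0.
Qed.

HB.instance Definition _ := GRing.Zmodule_isNzRing.Build H
  daha_mulA daha_mul1l daha_mul1r daha_mulDl daha_mulDr daha_one_neq0.

Fact daha_scalerA a b x : daha_scale a (daha_scale b x) = daha_scale (a * b) x.
Proof.
rewrite !daha_scaleE daha_mulA; congr daha_mul.
by rewrite daha_piM; apply/daha_piP/DscalM.
Qed.
Fact daha_scale1r : left_id 1 daha_scale.
Proof. by move=> x; rewrite daha_scaleE daha_mul1l. Qed.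
Fact daha_scalerDr : right_distributive daha_scale +%R.
Proof. by move=> a x y; rewrite !daha_scaleE; apply: daha_mulDr. Qed.
Fact daha_scalerDl x : {morph daha_scale^~ x : a b / a + b}.
Proof.
by move=> a b; rewrite !daha_scaleE -daha_scalD; apply: daha_mulDl.
Qed.

HB.instance Definition _ := GRing.Zmodule_isLmodule.Build F H
  daha_scalerA daha_scale1r daha_scalerDr daha_scalerDl.

Fact daha_scalerAl (a : F) (x y : H) : a *: (x * y) = a *: x * y.
Proof.
by rewrite -![_ *: _]/(daha_scale _ _) !daha_scaleE; apply: daha_mulA.
Qed.

HB.instance Definition _ := GRing.Lmodule_isLalgebra.Build F H daha_scalerAl.

Fact daha_scalerAr (a : F) (x y : H) : a *: (x * y) = x * (a *: y).
Proof.
rewrite -![_ *: _]/(daha_scale _ _) !daha_scaleE.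
rewrite -![_ * _]/(daha_mul _ _) !daha_mulA; congr daha_mul.
elim/daha_ind: x => x; rewrite !daha_piM; exact/daha_piP/DscalC.
Qed.

HB.instance Definition _ := GRing.Lalgebra_isAlgebra.Build F H daha_scalerAr.

Definition daha_gen (i : 'I_4) : H := daha_pi (Dgen F i).
Definition daha_inv (i : 'I_4) : H := daha_pi (Dinv F i).

Lemma daha_scalE (a : F) : daha_pi (Dscal a) = a%:A.
Proof. by rewrite -[RHS]/(daha_scale _ _) daha_scaleE daha_mul1r. Qed.

Lemma daha_gen_rel : daha_rel q daha_gen daha_inv.
Proof.
rewrite /daha_gen /daha_inv; split=> [i|i|i j|].
- by apply: etrans (daha_piM _ _) _; apply/daha_piP/DgenV.
- by apply: etrans (daha_piM _ _) _; apply/daha_piP/DVgen.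
- rewrite -![_ + _]/(daha_add _ _) -![_ * _]/(daha_mul _ _) daha_piD !daha_piM.
  exact/daha_piP/Dcentral.
- rewrite -![_ * _]/(daha_mul _ _) !daha_piM -daha_scalE.
  exact/daha_piP/Dprod.
Qed.

End DahaAlgebra.

Section RepModule.
Variables (F : fieldType) (q : F) (q_neq0 : q != 0) (n : nat).
Variables (t t' : 'I_4 -> 'M[F]_n.+1) (rel : daha_rel q t t').
Local Notation H := (daha q_neq0).

Definition daha_lift (h : H) : 'M[F]_n.+1 := daha_eval t t' (daha_repr h).

Lemma daha_lift_pi x : daha_lift (daha_pi q_neq0 x) = daha_eval t t' x.
Proof. exact/(daha_eval_cong rel)/daha_repr_pi. Qed.

(* Column vectors, on which [h] acts by left multiplication by [daha_lift h]. *)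
Definition rep_module & daha_rel q t t' & q != 0 : Type := 'cV[F]_n.+1.
Local Notation V := (rep_module rel q_neq0).

HB.instance Definition _ := GRing.Zmodule.copy V 'cV[F]_n.+1.

Definition rep_scale (h : H) (v : V) : V := daha_lift h *m (v : 'cV[F]_n.+1).

Fact rep_scalerA a b v : rep_scale a (rep_scale b v) = rep_scale (a * b) v.
Proof.
rewrite /rep_scale mulmxA; congr (_ *m _).
elim/daha_ind: a => a; elim/daha_ind: b => b.
by rewrite -[_ * _]/(daha_mul _ _) daha_piM !daha_lift_pi.
Qed.
Fact rep_scale1r : left_id 1 rep_scale.
Proof.
by move=> v; rewrite /rep_scale -[1]/(daha_pi q_neq0 (Dscal 1)) daha_lift_pi /= scale1r mul1mx.
Qed.
Fact rep_scalerDr : right_distributive rep_scale +%R.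
Proof. by move=> h u v; rewrite /rep_scale mulmxDr. Qed.
Fact rep_scalerDl v : {morph rep_scale^~ v : a b / a + b}.
Proof.
move=> a b; rewrite /rep_scale -mulmxDl; congr (_ *m _).
elim/daha_ind: a => a; elim/daha_ind: b => b.
by rewrite -[_ + _]/(daha_add _ _) daha_piD !daha_lift_pi.
Qed.

HB.instance Definition _ := GRing.Zmodule_isLmodule.Build H V
  rep_scalerA rep_scale1r rep_scalerDr rep_scalerDl.

Lemma rep_genE i (v : V) : daha_gen q_neq0 i *: v = t i *m (v : 'cV[F]_n.+1).
Proof. by rewrite -[LHS]/(rep_scale _ _) /rep_scale daha_lift_pi. Qed.

End RepModule.

Section OFormulas.
Variables (F : fieldType) (q : F) (d : nat) (k : 4.-tuple F).
Local Notation k0 := (tnth k ix0).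
Local Notation k1 := (tnth k ix1).
Local Notation k2 := (tnth k ix2).
Local Notation k3 := (tnth k ix3).

(* The basis v_0, ..., v_d; note that [Ov i = 0] for i > d. *)
Definition Ov (i : nat) : 'cV[F]_d.+1 := \col_l (l == i :> nat)%:R.

(* The vectors t_0 v_i, t_1 v_i, t_2 v_i and t_3 v_i for i <= d (d even).
   As i <= d, the subtractions below are not truncated; a negative power
   q^{-n} is [q ^- n]. *)
Definition Ot0 (i : nat) : 'cV[F]_d.+1 :=
  if i == 0 then k0 *: Ov 0
  else if odd i then (k0^-1 * q ^- (i + 1)) *: (Ov i - Ov (i + 1))
  else (k0^-1 * q ^- i * (1 - q ^+ i) * (1 - k0 ^+ 2 * q ^+ i)) *: Ov (i - 1)
       + (k0 + k0^-1 - k0^-1 * q ^- i) *: Ov i.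

Definition Ot1 (i : nat) : 'cV[F]_d.+1 :=
  if odd i then k1^-1 *: Ov i
  else if i == 0 then k1 *: Ov 0 + k1^-1 *: Ov 1
  else if i == d then
    - (k1 * (1 - q ^+ d) * (1 - k0 ^+ 2 * q ^+ d)) *: Ov (d - 1) + k1 *: Ov d
  else - (k1 * (1 - q ^+ i) * (1 - k0 ^+ 2 * q ^+ i)) *: Ov (i - 1)
       + k1 *: Ov i + k1^-1 *: Ov (i + 1).

Definition Ot2 (i : nat) : 'cV[F]_d.+1 :=
  if i == d then k2 *: Ov d
  else if odd i then
    - (k2 * (1 - k2 ^- 2 * q ^- (d + 1 - i)) * (1 - q ^+ (d + 1 - i)))
      *: Ov (i - 1)
    + (k2 + k2^-1 - k2 * q ^+ (d + 1 - i)) *: Ov i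
  else (k2 * q ^+ (d - i)) *: (Ov i - Ov (i + 1)).

Definition Ot3 (i : nat) : 'cV[F]_d.+1 :=
  if odd i then
    - (k3^-1 * (1 - k2 ^- 2 * q ^- (d + 1 - i)) * (1 - q ^- (d + 1 - i)))
      *: Ov (i - 1)
    + k3^-1 *: Ov i + k3 *: Ov (i + 1)
  else k3 *: Ov i.

Definition op_of (f : nat -> 'cV[F]_d.+1) : 'M[F]_d.+1 :=
  \matrix_(l, j) f j l 0.

Definition Ogen (i : 'I_4) : 'M[F]_d.+1 :=
  tnth [tuple op_of Ot0; op_of Ot1; op_of Ot2; op_of Ot3] i.

End OFormulas.

Definition Oparam (F : fieldType) (q : F) (d : nat) : Type :=
  {k : 4.-tuple F | [forall i, tnth k i != 0]
                    && (\prod_(i < 4) tnth k i == q ^- d.+1)}.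

Section ORelations.
Variables (F : fieldType) (q : F) (d : nat).
Hypothesis q_neq0 : q != 0.
Hypothesis d_even : ~~ odd d.

Lemma op_ofE f j : (j <= d)%N -> op_of f *m Ov F d j = f j.
Proof.
move=> jd; apply/matrixP=> l c; rewrite ord1 !mxE.
rewrite (bigD1 (Ordinal (jd : (j < d.+1)%N))) //= !mxE eqxx mulr1.
rewrite big1 ?addr0 // => i ij; rewrite !mxE.
by rewrite -(inj_eq val_inj) /= in ij; rewrite (negPf ij) mulr0.
Qed.

Lemma Ov_out j : (d < j)%N -> Ov F d j = 0.
Proof.
move=> dj; apply/matrixP=> l c; rewrite !mxE.
by rewrite ltn_eqF // (leq_trans (ltn_ord l)).
Qed.

Lemma op_eq (A B : 'M[F]_d.+1) :
  (forall j, (j <= d)%N -> A *m Ov F d j = B *m Ov F d j) -> A = B.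
Proof.
move=> AB; apply/matrixP=> i j; have /matrixP/(_ i 0) := AB j (leq_ord j).
have col (C : 'M[F]_d.+1) : (C *m Ov F d j) i 0 = C i j.
  rewrite !mxE (bigD1 j) //= !mxE eqxx mulr1 big1 ?addr0 // => l lj.
  by rewrite !mxE -[_ == _ :> nat]/(l == j) (negPf lj) mulr0.
by rewrite !col.
Qed.

Variable k : 4.-tuple F.
Hypothesis Ok_neq0 : forall i, tnth k i != 0.
Hypothesis Ok_prodE : \prod_(i < 4) tnth k i = q ^- d.+1.
Local Notation k0 := (tnth k ix0).
Local Notation k1 := (tnth k ix1).
Local Notation k2 := (tnth k ix2).
Local Notation k3 := (tnth k ix3).
Local Notation v := (Ov F d).
Local Notation T0 := (op_of (Ot0 q d k)).
Local Notation T1 := (op_of (Ot1 q d k)).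
Local Notation T2 := (op_of (Ot2 q d k)).
Local Notation T3 := (op_of (Ot3 q d k)).
Local Notation Q := (q ^+ d.+1).

Lemma Ok_prod : Q = (k0 * k1 * k2 * k3)^-1.
Proof.
rewrite -[LHS]invrK -Ok_prodE; congr _^-1.
rewrite !big_ord_recl big_ord0 mulr1 !mulrA.
by congr (_ * _ * _ * _); congr (tnth k _); apply/val_inj.
Qed.

Lemma q_expB j : (j <= d.+1)%N -> q ^+ (d + 1 - j) = Q / q ^+ j.
Proof. by move=> jd; rewrite addn1 expfB_cond ?(negPf q_neq0) ?add0n. Qed.

Lemma qX_neq0 j : q ^+ j != 0. Proof. by rewrite expf_neq0. Qed.

Lemma T0_even j : ~~ odd j -> (j <= d)%N -> T0 *m v j =
  (k0^-1 * q ^- j * (1 - q ^+ j) * (1 - k0 ^+ 2 * q ^+ j)) *: v j.-1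
  + (k0 + k0^-1 - k0^-1 * q ^- j) *: v j.
Proof.
move=> je jd; rewrite op_ofE // /Ot0; case: eqP => [->|_].
  by rewrite expr0 subrr mulr0 mul0r scale0r add0r invr1 mulr1 addrK.
by rewrite (negPf je) subn1.
Qed.

Lemma T0_odd j : odd j -> (j <= d.+1)%N -> T0 *m v j =
  (k0^-1 * q ^- j.+1) *: (v j - v j.+1).
Proof.
rewrite leq_eqVlt => jo /orP[/eqP ->|jd].
  by rewrite !Ov_out // subrr mulmx0 scaler0.
by rewrite op_ofE // /Ot0 jo addn1; case: j jo {jd}.
Qed.

Lemma T1_even j : ~~ odd j -> (j <= d)%N -> T1 *m v j =
  - (k1 * (1 - q ^+ j) * (1 - k0 ^+ 2 * q ^+ j)) *: v j.-1
  + k1 *: v j + k1^-1 *: v j.+1.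
Proof.
move=> je jd; rewrite op_ofE // /Ot1 (negPf je); case: eqP => [->|_].
  by rewrite expr0 subrr mulr0 mul0r oppr0 scale0r add0r.
case: eqP => [->|_]; last by rewrite subn1 addn1.
by rewrite (@Ov_out d.+1) // scaler0 addr0 subn1.
Qed.

Lemma T1_odd j : odd j -> (j <= d.+1)%N -> T1 *m v j = k1^-1 *: v j.
Proof.
rewrite leq_eqVlt => jo /orP[/eqP ->|jd].
  by rewrite !Ov_out // mulmx0 scaler0.
by rewrite op_ofE // /Ot1 jo.
Qed.

Lemma T2_even j : ~~ odd j -> (j <= d)%N -> T2 *m v j =
  (k2 * (Q / q ^+ j.+1)) *: (v j - v j.+1).
Proof.
move=> je jd; rewrite op_ofE // /Ot2 (negPf je); case: eqP => [->|_].
  by rewrite divff ?qX_neq0 // (@Ov_out d.+1) // subr0 mulr1.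
by rewrite -q_expB // !addn1 subSS.
Qed.

Lemma T2_odd j : odd j -> (j <= d.+1)%N -> T2 *m v j =
  - (k2 * (1 - k2 ^- 2 * (Q / q ^+ j)^-1) * (1 - Q / q ^+ j)) *: v j.-1
  + (k2 + k2^-1 - k2 * (Q / q ^+ j)) *: v j.
Proof.
rewrite leq_eqVlt => jo /orP[/eqP ->|jd].
  rewrite (@Ov_out d.+1) // mulmx0 divff ?qX_neq0 // subrr mulr0 oppr0.
  by rewrite scaler0 scale0r addr0.
rewrite op_ofE // /Ot2 jo; case: eqP => [jE|_].
  by move: d_even; rewrite -jE jo.
by rewrite q_expB ?subn1 // leqW.
Qed.

Lemma T3_even j : ~~ odd j -> (j <= d)%N -> T3 *m v j = k3 *: v j.
Proof. by move=> je jd; rewrite op_ofE // /Ot3 (negPf je). Qed.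

Lemma T3_odd j : odd j -> (j <= d.+1)%N -> T3 *m v j =
  - (k3^-1 * (1 - k2 ^- 2 * (Q / q ^+ j)^-1) * (1 - (Q / q ^+ j)^-1)) *: v j.-1
  + k3^-1 *: v j + k3 *: v j.+1.
Proof.
rewrite leq_eqVlt => jo /orP[/eqP ->|jd].
  rewrite (@Ov_out d.+1) // (@Ov_out d.+2) // mulmx0 divff ?qX_neq0 // invr1 subrr mulr0 oppr0.
  by rewrite !scaler0 scale0r !addr0.
by rewrite op_ofE // /Ot3 jo q_expB ?subn1 ?addn1 // leqW.
Qed.

Ltac O_entries :=
  apply/matrixP=> l c; rewrite !mxE;
  repeat match goal with |- context [(nat_of_bool ?b)%:R] =>
    let x := fresh "x" in set x : F := (nat_of_bool b)%:R; clearbody x end;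
  rewrite ?exprS ?expr0;
  repeat match goal with |- context [q ^+ ?j] =>
    let a := fresh "a" in
    have : q ^+ j != 0 := qX_neq0 j; set a := q ^+ j; clearbody a; move=> ? end.

Ltac O_side := rewrite ?oner_eq0 ?andbT; do ?[apply/andP; split].

Let k0n := Ok_neq0 ix0.
Let k1n := Ok_neq0 ix1.
Let k2n := Ok_neq0 ix2.
Let k3n := Ok_neq0 ix3.

Lemma even_pred j : ~~ odd j.+1 -> odd j. Proof. by rewrite /= negbK. Qed.

Lemma odd_lt j : odd j -> (j <= d)%N -> (j < d)%N.
Proof.
by move=> jo jd; rewrite ltn_neqAle jd andbT; apply: contraNneq d_even => <-.
Qed.

Lemma k3E : k3 = (k0 * k1 * k2 * Q)^-1.
Proof. by rewrite Ok_prod; field; O_side. Qed.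

Ltac O_dist := do 3!rewrite ?(mulmxDr, mulmxN) -?scalemxAr.

Lemma quad0 : T0 *m ((k0 + k0^-1)%:M - T0) = 1%:M.
Proof.
apply: op_eq => j jd; rewrite -mulmxA mulmxBl !mul_scalar_mx scale1r.
case: (boolP (odd j)) => [jo|je].
  have jd' := odd_lt jo jd; have je1 : ~~ odd j.+1 by rewrite /= negbK.
  rewrite (T0_odd jo (leqW jd)); O_dist.
  rewrite (T0_odd jo (leqW jd)) (T0_even je1 jd') /=.
  by O_entries; field; O_side.
case: j je jd => [je jd|j je jd].
  rewrite (T0_even je jd) /=; O_dist; rewrite (T0_even je jd) /=.
  by O_entries; field; O_side.
have jo := even_pred je; have jd' := leqW (ltnW jd).
rewrite (T0_even je jd) /=; O_dist.
rewrite (T0_even je jd) (T0_odd jo jd') /=.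
by O_entries; field; O_side.
Qed.

Lemma quad1 : T1 *m ((k1 + k1^-1)%:M - T1) = 1%:M.
Proof.
apply: op_eq => j jd; rewrite -mulmxA mulmxBl !mul_scalar_mx scale1r.
case: (boolP (odd j)) => [jo|je].
  rewrite (T1_odd jo (leqW jd)); O_dist; rewrite (T1_odd jo (leqW jd)).
  by O_entries; field; O_side.
have jd1 : (j.+1 <= d.+1)%N by [].
rewrite (T1_even je jd) /=; O_dist; rewrite (T1_even je jd).
rewrite (@T1_odd j.+1 je jd1).
case: j je jd {jd1} => [_ _|j je jd] /=; last first.
  rewrite (T1_odd (even_pred je) (leqW (ltnW jd))).
  by O_entries; field; O_side.
by rewrite expr0 subrr mulr0 mul0r oppr0 !scale0r; O_entries; field; O_side.
Qed.

Lemma quad2 : T2 *m ((k2 + k2^-1)%:M - T2) = 1%:M.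
Proof.
apply: op_eq => j jd; rewrite -mulmxA mulmxBl !mul_scalar_mx scale1r.
case: (boolP (odd j)) => [jo|je].
  case: j jo jd => // j je jd.
  rewrite (T2_odd je (leqW jd)) /=; O_dist.
  rewrite (T2_odd je (leqW jd)) (T2_even je (ltnW jd)) /=.
  by rewrite Ok_prod; O_entries; field; O_side.
rewrite (T2_even je jd); O_dist; rewrite (T2_even je jd) (@T2_odd j.+1) //=.
by rewrite Ok_prod; O_entries; field; O_side.
Qed.

Lemma quad3 : T3 *m ((k3 + k3^-1)%:M - T3) = 1%:M.
Proof.
apply: op_eq => j jd; rewrite -mulmxA mulmxBl !mul_scalar_mx scale1r.
case: (boolP (odd j)) => [jo|je].
  have jd' := odd_lt jo jd; have je1 : ~~ odd j.+1 by rewrite /= negbK.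
  case: j jo jd jd' je1 => // j je jd jd' je1.
  rewrite (T3_odd je (leqW jd)) /=; O_dist.
  rewrite (T3_odd je (leqW jd)) (T3_even je1 jd') (T3_even je (ltnW jd)) /=.
  by rewrite Ok_prod; O_entries; field; O_side.
rewrite (T3_even je jd); O_dist; rewrite (T3_even je jd).
by O_entries; field; O_side.
Qed.

Lemma prod23 : T2 *m T3 =
  q^-1 *: (((k1 + k1^-1)%:M - T1) *m ((k0 + k0^-1)%:M - T0)).
Proof.
apply: op_eq => j jd.
rewrite -scalemxAl -!mulmxA !mulmxBl !mul_scalar_mx.
case: (boolP (odd j)) => [jo|je].
  have jd' := odd_lt jo jd; have je1 : ~~ odd j.+1 by rewrite /= negbK.
  case: j jo jd jd' je1 => // j je jd jd' je1.
  rewrite (T3_odd je (leqW jd)) (T0_odd je (leqW jd)) /=; O_dist.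
  rewrite (T2_even je (ltnW jd)) (T2_even je1 jd') (T2_odd je (leqW jd)) /=.
  rewrite (T1_odd je (leqW jd)) (T1_even je1 jd') /=.
  by rewrite k3E; O_entries; field; O_side.
rewrite (T3_even je jd) (T0_even je jd); O_dist.
rewrite (T2_even je jd) (T1_even je jd).
case: j je jd => [_ _|j je jd] /=.
  by rewrite expr0 subrr !(mulr0, mul0r, oppr0, scale0r) k3E /=;
     O_entries; field; O_side.
rewrite (T1_odd (even_pred je) (leqW (ltnW jd))).
by rewrite k3E; O_entries; field; O_side.
Qed.

End ORelations.

Section OModule.
Variables (F : fieldType) (q : F) (q_neq0 : q != 0).
Variables (d : nat) (d_even : ~~ odd d) (k : Oparam q d).
Local Notation kk := (val k : 4.-tuple F).

(* t_i^{-1} acts as k_i + k_i^{-1} - t_i. *)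
Definition Oinv (i : 'I_4) : 'M[F]_d.+1 :=
  (tnth kk i + (tnth kk i)^-1)%:M - Ogen q d kk i.

Lemma O_rel : daha_rel q (Ogen q d kk) Oinv.
Proof.
have /andP[/forallP kn /eqP kP] := valP k.
have TV i : Ogen q d kk i *m Oinv i = 1%:M.
  by rewrite /Oinv; case: i => -[|[|[|[|//]]]] lt; rewrite (bool_irrelevance lt isT);
    [exact: quad0|exact: quad1|exact: quad2|exact: quad3].
split=> [i|i|i j|].
- exact: TV.
- exact/mulmx1C/TV.
- by rewrite /Oinv addrCA subrr addr0; apply: esym; exact: scalar_mxC.
have -> : Ogen q d kk ix0 * Ogen q d kk ix1 * Ogen q d kk ix2 * Ogen q d kk ix3 =
    Ogen q d kk ix0 *m Ogen q d kk ix1 *m (Ogen q d kk ix2 *m Ogen q d kk ix3).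
  by rewrite mulmxA.
have -> : Ogen q d kk ix2 *m Ogen q d kk ix3 = q^-1 *: (Oinv ix1 *m Oinv ix0).
  exact: prod23.
rewrite -scalemxAr; congr (_ *: _).
by rewrite -mulmxA (mulmxA (Ogen q d kk ix1)) TV mul1mx TV.
Qed.

(* The left module O(k_0, k_1, k_2, k_3); [Omod_genE] gives the action on the
   basis v_0, ..., v_d. *)
Definition Omod : lmodType (daha q_neq0) := rep_module O_rel q_neq0.

Lemma Omod_genE (j : nat) : (j <= d)%N ->
  [/\ daha_gen q_neq0 ix0 *: (Ov F d j : Omod) = Ot0 q d kk j,
      daha_gen q_neq0 ix1 *: (Ov F d j : Omod) = Ot1 q d kk j,
      daha_gen q_neq0 ix2 *: (Ov F d j : Omod) = Ot2 q d kk j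
    & daha_gen q_neq0 ix3 *: (Ov F d j : Omod) = Ot3 q d kk j].
Proof. by move=> jd; split; rewrite rep_genE; exact: op_ofE. Qed.

End OModule.

Section Modules.
Variables (F : fieldType) (q : F) (q_neq0 : q != 0).
Local Notation H := (daha q_neq0).

(* V as an F-space, through the structure map a |-> a%:A of the algebra. *)
Definition restrict_scalars (V : lmodType H) : Type := V.

Section RestrictScalars.
Variable V : lmodType H.
Local Notation U := (restrict_scalars V).

HB.instance Definition _ := GRing.Zmodule.copy U V.

Definition restrict_scale (a : F) (v : U) : U := (a%:A : H) *: (v : V).

Fact restrict_scalerA a b v :
  restrict_scale a (restrict_scale b v) = restrict_scale (a * b) v.
Proof. by rewrite /restrict_scale scalerA -scalerAl mul1r scalerA. Qed.
Fact restrict_scale1r : left_id 1 restrict_scale.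
Proof. by move=> v; rewrite /restrict_scale !scale1r. Qed.
Fact restrict_scalerDr : right_distributive restrict_scale +%R.
Proof. by move=> a u v; rewrite /restrict_scale scalerDr. Qed.
Fact restrict_scalerDl v : {morph restrict_scale^~ v : a b / a + b}.
Proof. by move=> a b; rewrite /restrict_scale !scalerDl. Qed.

HB.instance Definition _ := GRing.Zmodule_isLmodule.Build F U
  restrict_scalerA restrict_scale1r restrict_scalerDr restrict_scalerDl.

End RestrictScalars.

Definition has_dim (V : lmodType H) (n : nat) : Prop :=
  exists2 f : restrict_scalars V -> 'rV[F]_n, linear f & bijective f.

Definition irreducible_mod (V : lmodType H) : Prop :=
  (exists v : V, v != 0) /\
  forall S : {pred V}, GRing.submod_closed S -> S =i pred1 0 \/ S =i predT.

Definition mod_iso (V W : lmodType H) : Prop :=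
  exists f : {linear V -> W}, bijective f.

(* Plain predicates rather than [set (lmodType H)], which would be a universe
   inconsistency. *)
Definition iso_class (V : lmodType H) : lmodType H -> Prop :=
  fun W => mod_iso V W.

Definition OM (d : nat) : Type :=
  {C : lmodType H -> Prop |
    exists V, [/\ irreducible_mod V, has_dim V d.+1 & C = iso_class V]}.

End Modules.

Definition OP (F : fieldType) (q : F) (d : nat) : Type :=
  {k : Oparam q d |
    forall (j : 'I_4) (i : nat), (2 <= i <= d)%N -> ~~ odd i ->
      tnth (val k) j ^+ 2 != q ^- i}.

(* Main.v *)
Require Import Defs.
From HB Require Import structures.
From mathcomp Require Import all_boot all_order all_algebra.
From mathcomp Require Import boolp ring zify.

(** By Schur's lemma the central elements t_i + t_i^-1 act on an irreducible
    module by scalars c_i, so such a module of dimension d + 1 amounts to four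
    matrices T_i with T_i ^ 2 = c_i T_i - 1 and T_0 T_1 T_2 T_3 = q^-1.

    The parity of d enters through one fact: two matrices that satisfy such
    quadratic relations have a common eigenvector in every stable subspace of odd
    dimension ([odd_common_eigenvector]).

    Surjectivity. In an irreducible module of dimension d + 1 take a common
    eigenvector v_0 of t_0, t_3, with eigenvalues k0, k3, and a common left
    eigenvector f of t_1, t_2, with eigenvalues k1, k2. Starting from v_0, the
    formulas for t_1 v_j (j even) and t_0 v_j (j odd) define a sequence v_j, and
    the relations of the algebra imply all the other formulas of O(k), with
    (k0 k1 k2 k3)^-1 in place of q^(d+1). The form f kills every v_j but one,
    v_e, and e is even with k0 k1 k2 k3 = q^-(e+1); from this one deduces that
    v_j = 0 for j > e, that v_0, ..., v_e is a basis, and that e = d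
    ([simple_rep_intertwiner]). If k0 or k2 violated its condition then some tail
    v_i, ..., v_d would span a submodule. The conditions on k1 and k3 follow by
    applying the same result to the module rotated by t_i |-> t_{i+1}.

    Injectivity. The trace of t_i on O(k) is k_i + (d/2)(k_i + k_i^-1)
    ([Ogen_trace]), and t_i determines k_i + k_i^-1, hence k_i. The same traces
    identify the parameters of the rotated module.

    Irreducibility of O(k). The vector v_0 generates the module and the last
    coordinate form generates its dual. Under the conditions on k, v_0 is up to
    scalars the only common eigenvector of t_0, t_3, and the last coordinate form
    the only common left eigenvector of t_1, t_2: this is an elimination in the
    coordinates ([right_eigen_eq0], [left_eigen_eq0]). A submodule S or its
    annihilator has odd dimension, and contains such an eigenvector
    ([Ogen_simple]). *)

Set Implicit Arguments.
Unset Strict Implicit.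
Unset Printing Implicit Defensive.

Import GRing.Theory.
Local Open Scope ring_scope.

(** * Common eigenvectors in odd dimension *)

Section CommonEigenvector.
Variables (F : fieldType) (n : nat).
Implicit Types (A B : 'M[F]_n).

Definition quadratic (c : F) A := A *m A = c *: A - 1%:M.

Lemma quadratic_factor (a : F) A : a != 0 -> quadratic (a + a^-1) A ->
  (A - a%:M) *m (A - a^-1%:M) = 0.
Proof.
move=> a0 qA; rewrite mulmxBl !mulmxBr qA mul_scalar_mx mul_mx_scalar.
by rewrite -scalar_mxM divff //; apply/matrixP=> i j; rewrite !mxE; ring.
Qed.

(** Because A ^ 2 is cA - 1, the commutator intertwines A with its inverse
    c - A; hence the kernel of the commutator is stable under A. *)
Lemma commutator_quadratic (c : F) A B : quadratic c A ->
  A *m (A *m B - B *m A) = (A *m B - B *m A) *m (c%:M - A).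
Proof.
move=> qA; rewrite mulmxBr !mulmxBl !mulmxBr !mul_mx_scalar !mulmxA qA.
rewrite -(mulmxA B) qA mulmxBl mulmxBr mul1mx mulmx1 -scalemxAl -scalemxAr.
by apply/matrixP=> i j; rewrite !mxE; ring.
Qed.

(** One of x and x(A - a) is an eigenvector. The last clause records this shape,
    so that an eigenvector of an operator commuting with A stays one. *)
Lemma quadratic_eigenvector m (W : 'M[F]_(m, n)) (a : F) A (x : 'rV[F]_n) :
  a != 0 -> quadratic (a + a^-1) A -> x != 0 -> (x <= W)%MS ->
  (W *m A <= W)%MS ->
  exists y, [/\ y != 0, (y <= W)%MS, exists b, y *m A = b *: y
              & exists b, y = x *m (A - b%:M) \/ y = x].
Proof.
move=> a0 qA x0 xW WA; have [/eqP|y0] := boolP (x *m (A - a%:M) == 0).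
  rewrite mulmxBr mul_mx_scalar => /subr0_eq xA.
  by exists x; split=> //; [exists a | exists a; right].
exists (x *m (A - a%:M)); split=> //.
- rewrite mulmxBr mul_mx_scalar addmx_sub ?eqmx_opp ?scalemx_sub //.
  exact: submx_trans (submxMr _ xW) WA.
- exists a^-1; apply/subr0_eq; rewrite -mul_mx_scalar -mulmxBr -mulmxA.
  by rewrite (quadratic_factor a0 qA) mulmx0.
- by exists a; left.
Qed.

(** Let K = AB - BA. The part of W killed by K is stable, and A and B commute on
    it, so a common eigenvector exists as soon as that part is nonzero.
    Otherwise K is injective on W; since K = (A - a)B - B(A - a), the rank of W
    is at most twice the rank of W(A - a), and likewise for a^-1. But (A - a)(A
    - a^-1) = 0, so these two ranks add up to at most the rank of W, which is
    then even. *)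
Lemma odd_common_eigenvector m (W : 'M[F]_(m, n)) A B (a b : F) :
  a != 0 -> b != 0 -> quadratic (a + a^-1) A -> quadratic (b + b^-1) B ->
  (W *m A <= W)%MS -> (W *m B <= W)%MS -> odd (\rank W) ->
  exists x : 'rV[F]_n, [/\ x != 0, (x <= W)%MS,
    exists l, x *m A = l *: x & exists l, x *m B = l *: x].
Proof.
move=> a0 b0 qA qB WA WB oddW; pose K := A *m B - B *m A.
pose E := (W :&: kermx K)%MS.
have EW : (E <= W)%MS by apply: capmxSl.
have EK (x : 'rV_n) : (x <= E)%MS = (x <= W)%MS && (x *m K == 0).
  by rewrite sub_capmx; congr (_ && _); apply/sub_kermxP/eqP.
have [E0|En0] := boolP (E == 0); last first.
  have nzE : nz_row E != 0 by rewrite nz_row_eq0.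
  have rE := nz_row_sub E.
  have EA : (E *m A <= E)%MS.
    rewrite sub_capmx (submx_trans (submxMr _ EW) WA) /=.
    apply/sub_kermxP; rewrite -mulmxA (commutator_quadratic B qA) mulmxA.
    by rewrite (sub_kermxP (capmxSr W (kermx K))) mul0mx.
  have EB : (E *m B <= E)%MS.
    rewrite sub_capmx (submx_trans (submxMr _ EW) WB) /=.
    apply/sub_kermxP; rewrite -mulmxA /K -opprB mulmxN.
    rewrite (commutator_quadratic A qB) -mulNmx opprB mulmxA.
    by rewrite (sub_kermxP (capmxSr W (kermx K))) mul0mx.
  have [x [x0 xE [l xA] _]] := quadratic_eigenvector a0 qA nzE rE EA.
  have [y [y0 yE yB [s ys]]] := quadratic_eigenvector b0 qB x0 xE EB.
  exists y; split=> //; first exact: submx_trans yE EW.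
  exists l; case: ys => -> //; rewrite -mulmxA mulmxBl mulmxBr.
  move: xE; rewrite EK mulmxBr !mulmxA subr_eq0 => /andP[_ /eqP xK].
  rewrite -xK xA mul_mx_scalar -!scalemxAl xA mulmxBr mul_mx_scalar.
  by rewrite scalerBr !scalerA (mulrC l).
have rK : \rank (W *m K) = \rank W.
  by have := mxrank_mul_ker W K; rewrite -/E (eqP E0) mxrank0 addn0.
have half (e : F) : (\rank W <= \rank (W *m (A - e%:M)) * 2)%N.
  have -> : \rank W = \rank (W *m (A - e%:M) *m B - W *m B *m (A - e%:M)).
    rewrite -rK; congr (\rank _). rewrite /K !mulmxBr !mulmxBl !mul_mx_scalar.
    by rewrite !mulmxA -scalemxAl opprB [RHS]addrA addrNK.
  rewrite muln2 -addnn (leq_trans (mxrank_add _ _)) // leq_add ?mxrankM_maxl //.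
  by rewrite mxrank_opp mxrankS // submxMr.
have := half a; have := half a^-1.
have : (\rank (W *m (A - a%:M)) + \rank (W *m (A - a^-1%:M)) <= \rank W)%N.
  rewrite -(mxrank_mul_ker W (A - a^-1%:M)) addnC leq_add2l mxrankS //.
  rewrite sub_capmx; apply/andP; split.
    by rewrite mulmxBr mul_mx_scalar addmx_sub ?eqmx_opp ?scalemx_sub.
  by apply/sub_kermxP; rewrite -mulmxA quadratic_factor // mulmx0.
move: oddW; move: (\rank W) (\rank (W *m _)) (\rank (W *m _)) => r s t.
have := odd_double_half r; case: (odd r) => // + _; lia.
Qed.

End CommonEigenvector.

(** * The Verma sequence of a common eigenvector *)

Ltac mx_field :=
  apply/matrixP=> ? ?; rewrite !mxE;
  repeat match goal with |- context [fun_of_matrix ?A ?i ?j] =>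
    let e := fresh "e" in move: (fun_of_matrix A i j) => e end;
  field; rewrite ?oner_eq0 ?andbT; do ?[apply/andP; split].

Section Verma.
Variables (F : fieldType) (q : F) (n : nat) (T0 T1 T2 T3 : 'M[F]_n).
Variables (k0 k1 k2 k3 : F).
Hypotheses (q0 : q != 0) (k00 : k0 != 0) (k10 : k1 != 0).
Hypotheses (k20 : k2 != 0) (k30 : k3 != 0).
Hypotheses (quad0 : quadratic (k0 + k0^-1) T0) (quad1 : quadratic (k1 + k1^-1) T1).
Hypotheses (quad2 : quadratic (k2 + k2^-1) T2) (quad3 : quadratic (k3 + k3^-1) T3).
Hypothesis prodT : T0 *m T1 *m T2 *m T3 = q^-1%:M.
Local Notation Q := (k0 * k1 * k2 * k3)^-1.
Implicit Types x y z : 'cV[F]_n.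

Lemma quadratic_mul m (c : F) (A : 'M[F]_n) (x : 'M[F]_(n, m)) : quadratic c A ->
  A *m (A *m x) = c *: (A *m x) - x.
Proof. by move=> qA; rewrite mulmxA qA mulmxBl mul1mx -scalemxAl. Qed.

Lemma quadratic_mulK (c : F) A (x : 'cV[F]_n) : quadratic c A ->
  (c%:M - A) *m (A *m x) = x.
Proof.
by move=> qA; rewrite mulmxBl mul_scalar_mx (quadratic_mul _ qA) subKr.
Qed.

(** The product relation, with t_0 and t_1 moved to the other side. *)
Lemma T23E x : T2 *m (T3 *m x) =
  q^-1 *: (((k1 + k1^-1)%:M - T1) *m (((k0 + k0^-1)%:M - T0) *m x)).
Proof.
have : T0 *m (T1 *m (T2 *m (T3 *m x))) = q^-1 *: x.
  by rewrite !mulmxA prodT mul_scalar_mx.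
move/(congr1 (mulmx ((k0 + k0^-1)%:M - T0))); rewrite quadratic_mulK //.
move/(congr1 (mulmx ((k1 + k1^-1)%:M - T1))); rewrite quadratic_mulK // => ->.
by rewrite -!scalemxAr.
Qed.

(** The product relation read as a formula for the inverse of t_3. *)
Lemma T3VE x : ((k3 + k3^-1)%:M - T3) *m x = q *: (T0 *m (T1 *m (T2 *m x))).
Proof.
have H : T0 *m T1 *m T2 *m (q *: T3) = 1%:M.
  by rewrite -scalemxAr prodT -mul_scalar_mx -scalar_mxM divff.
have H' : (q *: T3) *m (T0 *m T1 *m T2) = 1%:M by apply: mulmx1C.
rewrite -[in LHS](mul1mx x) -H' mulmxA -!mulmxA -scalemxAl -scalemxAr.
by rewrite quadratic_mulK.
Qed.

(** From an even index to the next one: x, y, z stand for v_{j-1}, v_j, v_{j+1}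
    and s for q^j. The vector z is chosen so that t_1 y has the expected form;
    T_2 y then comes from the product relation, and T_1 z, T_2 z from the
    quadratic relations. *)
Lemma verma_step_even x y z (s : F) : s != 0 ->
  T0 *m y = (k0^-1 * s^-1 * (1 - s) * (1 - k0 ^+ 2 * s)) *: x
            + (k0 + k0^-1 - k0^-1 * s^-1) *: y ->
  T3 *m y = k3 *: y -> T1 *m x = k1^-1 *: x ->
  z = k1 *: (T1 *m y - k1 *: y + (k1 * (1 - s) * (1 - k0 ^+ 2 * s)) *: x) ->
  [/\ T1 *m y = - (k1 * (1 - s) * (1 - k0 ^+ 2 * s)) *: x + k1 *: y + k1^-1 *: z,
      T1 *m z = k1^-1 *: z,
      T2 *m y = (k2 * (Q / (q * s))) *: (y - z)
    & T2 *m z = - (k2 * (1 - k2 ^- 2 * (Q / (q * s))^-1) * (1 - Q / (q * s))) *: y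
                + (k2 + k2^-1 - k2 * (Q / (q * s))) *: z].
Proof.
move=> s0 T0y T3y T1x zE.
have T1y : T1 *m y =
    - (k1 * (1 - s) * (1 - k0 ^+ 2 * s)) *: x + k1 *: y + k1^-1 *: z.
  by rewrite zE; mx_field.
have T1z : T1 *m z = k1^-1 *: z.
  rewrite zE; do 3!rewrite ?(mulmxDr, mulmxN) -?scalemxAr.
  by rewrite (quadratic_mul _ quad1) T1x; mx_field.
have T2y : T2 *m y = (k2 * (Q / (q * s))) *: (y - z).
  have := T23E y; rewrite T3y -scalemxAr => /(canRL (scalerK k30)) ->.
  rewrite !mulmxBl !mul_scalar_mx T0y.
  do 3!rewrite ?(mulmxDr, mulmxN) -?scalemxAr.
  rewrite T1x T1y.
  by mx_field.
split=> //.
have zE2 : z = y - (k2 * (Q / (q * s)))^-1 *: (T2 *m y).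
  by rewrite T2y; mx_field.
rewrite {1}zE2 mulmxBr -scalemxAr (quadratic_mul _ quad2) T2y.
by mx_field.
Qed.

(** From an odd index to the next one: x, y, z, w stand for v_{j-2}, v_{j-1},
    v_j, v_{j+1} and s for q^{j-1}. The hypothesis on T_0 x carries the
    coefficient with which x occurs, because x vanishes and fails the bare
    formula when j = 1. *)
Lemma verma_step_odd x y z w (s : F) : s != 0 ->
  T0 *m y = (k0^-1 * s^-1 * (1 - s) * (1 - k0 ^+ 2 * s)) *: x
            + (k0 + k0^-1 - k0^-1 * s^-1) *: y ->
  T3 *m y = k3 *: y ->
  ((1 - s) * (1 - k0 ^+ 2 * s)) *: (T0 *m x) =
    ((1 - s) * (1 - k0 ^+ 2 * s) * (k0^-1 * s^-1)) *: (x - y) ->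
  T1 *m y = - (k1 * (1 - s) * (1 - k0 ^+ 2 * s)) *: x + k1 *: y + k1^-1 *: z ->
  T1 *m z = k1^-1 *: z ->
  T2 *m z = - (k2 * (1 - k2 ^- 2 * (Q / (q * s))^-1) * (1 - Q / (q * s))) *: y
                + (k2 + k2^-1 - k2 * (Q / (q * s))) *: z ->
  w = z - (k0 * (q * (q * s))) *: (T0 *m z) ->
  [/\ T0 *m z = (k0^-1 * (q * (q * s))^-1) *: (z - w),
      T0 *m w = (k0^-1 * (q * (q * s))^-1 * (1 - q * (q * s))
                   * (1 - k0 ^+ 2 * (q * (q * s)))) *: z
                + (k0 + k0^-1 - k0^-1 * (q * (q * s))^-1) *: w,
      T3 *m z = - (k3^-1 * (1 - k2 ^- 2 * (Q / (q * s))^-1)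
                     * (1 - (Q / (q * s))^-1)) *: y + k3^-1 *: z + k3 *: w
    & T3 *m w = k3 *: w].
Proof.
move=> s0 T0y T3y T0x T1y T1z T2z wE.
have T0z : T0 *m z = (k0^-1 * (q * (q * s))^-1) *: (z - w).
  by rewrite wE; mx_field.
have T0w : T0 *m w = (k0^-1 * (q * (q * s))^-1 * (1 - q * (q * s))
                   * (1 - k0 ^+ 2 * (q * (q * s)))) *: z
                + (k0 + k0^-1 - k0^-1 * (q * (q * s))^-1) *: w.
  by rewrite {1}wE mulmxBr -scalemxAr (quadratic_mul _ quad0) T0z; mx_field.
have T3z : T3 *m z = - (k3^-1 * (1 - k2 ^- 2 * (Q / (q * s))^-1)
                     * (1 - (Q / (q * s))^-1)) *: y + k3^-1 *: z + k3 *: w.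
  have -> : T3 *m z = (k3 + k3^-1) *: z - q *: (T0 *m (T1 *m (T2 *m z))).
    by rewrite -T3VE mulmxBl mul_scalar_mx subKr.
  rewrite T2z.
  do 2!rewrite ?(mulmxDr, mulmxN) -?scalemxAr.
  rewrite T1z T1y; do 3!rewrite ?(mulmxDr, mulmxN) -?scalemxAr.
  have -> : (- (k1 * (1 - s) * (1 - k0 ^+ 2 * s))) *: (T0 *m x) =
     (- (k1 * (1 - s) * (1 - k0 ^+ 2 * s) * (k0^-1 * s^-1))) *: (x - y).
    have E1 : - (k1 * (1 - s) * (1 - k0 ^+ 2 * s)) =
        - k1 * ((1 - s) * (1 - k0 ^+ 2 * s)) by ring.
    by rewrite E1 -scalerA T0x scalerA; congr (_ *: _); ring.
  by rewrite T0y T0z; mx_field.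
split=> //.
have wE2 : w = k3^-1 *: (T3 *m z - k3^-1 *: z) +
    (k3^-1 * (k3^-1 * (1 - k2 ^- 2 * (Q / (q * s))^-1)
                     * (1 - (Q / (q * s))^-1))) *: y.
  by rewrite T3z; mx_field.
rewrite {1}wE2; do 3!rewrite ?(mulmxDr, mulmxN) -?scalemxAr.
by rewrite (quadratic_mul _ quad3) T3y T3z; mx_field.
Qed.


Section Sequence.
Variable v0 : 'cV[F]_n.
Hypotheses (T0v0 : T0 *m v0 = k0 *: v0) (T3v0 : T3 *m v0 = k3 *: v0).

(** The pair (v_{j-1}, v_j), starting with v_{-1} = 0: each vector is produced
    from the two preceding ones by solving the formula for T_1 v_j (j even) or
    T_0 v_j (j odd) for v_{j+1}. *)
Fixpoint verma_pair (j : nat) : 'cV[F]_n * 'cV[F]_n :=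
  if j is i.+1 then
    let: (x, y) := verma_pair i in
    (y, if odd i then y - (k0 * q ^+ i.+1) *: (T0 *m y)
        else k1 *: (T1 *m y - k1 *: y
                    + (k1 * (1 - q ^+ i) * (1 - k0 ^+ 2 * q ^+ i)) *: x))
  else (0, v0).
Definition verma j := (verma_pair j).2.
Local Notation v := verma.

Lemma verma_pairS j : (verma_pair j.+1).1 = v j.
Proof. by rewrite /v /=; case: verma_pair. Qed.

Lemma vermaS j : v j.+1 =
  if odd j then v j - (k0 * q ^+ j.+1) *: (T0 *m v j)
  else k1 *: (T1 *m v j - k1 *: v j
              + (k1 * (1 - q ^+ j) * (1 - k0 ^+ 2 * q ^+ j)) *: (verma_pair j).1).
Proof. by rewrite /v /=; case: verma_pair. Qed.

Lemma verma_invariant h (j := h.*2) (s := q ^+ j) (x := (verma_pair j).1) :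
  [/\ T0 *m v j = (k0^-1 * s^-1 * (1 - s) * (1 - k0 ^+ 2 * s)) *: x
            + (k0 + k0^-1 - k0^-1 * s^-1) *: v j,
      T3 *m v j = k3 *: v j, T1 *m x = k1^-1 *: x
    & ((1 - s) * (1 - k0 ^+ 2 * s)) *: (T0 *m x) =
      ((1 - s) * (1 - k0 ^+ 2 * s) * (k0^-1 * s^-1)) *: (x - v j)].
Proof.
rewrite {}/x {}/s {}/j; elim: h => [|h [T0y T3y T1x T0x]].
  rewrite /v /= expr0 subrr !mul0r !scale0r mulmx0 !scaler0.
  by rewrite add0r invr1 mulr1 addrK.
have sn0 : q ^+ h.*2 != 0 by rewrite expf_neq0.
have := vermaS h.*2; rewrite odd_double => zE.
have [T1y T1z T2y T2z] := verma_step_even sn0 T0y T3y T1x zE.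
have wE : v h.*2.+2 =
    v h.*2.+1 - (k0 * (q * (q * q ^+ h.*2))) *: (T0 *m v h.*2.+1).
  by rewrite vermaS /= odd_double -!exprS.
have [T0z T0w T3z T3w] := verma_step_odd sn0 T0y T3y T0x T1y T1z T2z wE.
have e : q ^+ h.*2.+2 = q * (q * q ^+ h.*2) by rewrite !exprS.
rewrite doubleS verma_pairS e; split=> //.
by rewrite T0z scalerA.
Qed.

Lemma verma_relations h (j := h.*2) (s := q ^+ j) (x := (verma_pair j).1) :
  [/\ T1 *m v j = - (k1 * (1 - s) * (1 - k0 ^+ 2 * s)) *: x + k1 *: v j
                  + k1^-1 *: v j.+1,
      T1 *m v j.+1 = k1^-1 *: v j.+1,
      T2 *m v j = (k2 * (Q / (q * s))) *: (v j - v j.+1)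
    & T2 *m v j.+1 =
        - (k2 * (1 - k2 ^- 2 * (Q / (q * s))^-1) * (1 - Q / (q * s))) *: v j
                + (k2 + k2^-1 - k2 * (Q / (q * s))) *: v j.+1] /\
  [/\ T0 *m v j.+1 = (k0^-1 * (q * (q * s))^-1) *: (v j.+1 - v j.+2)
   & T3 *m v j.+1 = - (k3^-1 * (1 - k2 ^- 2 * (Q / (q * s))^-1)
                     * (1 - (Q / (q * s))^-1)) *: v j
                    + k3^-1 *: v j.+1 + k3 *: v j.+2].
Proof.
rewrite {}/x {}/s {}/j; have [T0y T3y T1x T0x] := verma_invariant h.
have sn0 : q ^+ h.*2 != 0 by rewrite expf_neq0.
have := vermaS h.*2; rewrite odd_double => zE.
have [T1y T1z T2y T2z] := verma_step_even sn0 T0y T3y T1x zE.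
have wE : v h.*2.+2 =
    v h.*2.+1 - (k0 * (q * (q * q ^+ h.*2))) *: (T0 *m v h.*2.+1).
  by rewrite vermaS /= odd_double -!exprS.
by have [T0z T0w T3z T3w] := verma_step_odd sn0 T0y T3y T0x T1y T1z T2z wE.
Qed.

Lemma odd_doubleS j : odd j -> j = j./2.*2.+1.
Proof. by move=> je; rewrite -[LHS]odd_double_half je. Qed.

(** The coefficient vanishes for j = 0, where v_{-1} and v_{0.-1} differ. *)
Lemma verma_pairE j (a : F) :
  (a * (1 - q ^+ j)) *: (verma_pair j).1 = (a * (1 - q ^+ j)) *: v j.-1.
Proof.
case: j => [|j]; last by rewrite verma_pairS.
by rewrite expr0 subrr mulr0 !scale0r.
Qed.

Lemma verma_T0_even j : ~~ odd j -> T0 *m v j =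
  (k0^-1 * q ^- j * (1 - q ^+ j) * (1 - k0 ^+ 2 * q ^+ j)) *: v j.-1
  + (k0 + k0^-1 - k0^-1 * q ^- j) *: v j.
Proof.
move=> je; have [+ _ _ _] := verma_invariant j./2.
by rewrite even_halfK // => ->; rewrite mulrAC verma_pairE mulrAC.
Qed.

Lemma verma_T0_odd j : odd j ->
  T0 *m v j = (k0^-1 * q ^- j.+1) *: (v j - v j.+1).
Proof.
move=> jo; have [_ [+ _]] := verma_relations j./2.
by rewrite -!exprS -odd_doubleS.
Qed.

Lemma verma_T1_even j : ~~ odd j -> T1 *m v j =
  - (k1 * (1 - q ^+ j) * (1 - k0 ^+ 2 * q ^+ j)) *: v j.-1
  + k1 *: v j + k1^-1 *: v j.+1.
Proof.
move=> je; have [[+ _ _ _] _] := verma_relations j./2.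
rewrite even_halfK // => ->; rewrite -!mulNr.
by rewrite mulrAC verma_pairE mulrAC.
Qed.

Lemma verma_T1_odd j : odd j -> T1 *m v j = k1^-1 *: v j.
Proof.
move=> jo; have [[_ + _ _] _] := verma_relations j./2.
by rewrite -odd_doubleS.
Qed.

Lemma verma_T2_even j : ~~ odd j ->
  T2 *m v j = (k2 * (Q / q ^+ j.+1)) *: (v j - v j.+1).
Proof.
move=> je; have [[_ _ + _] _] := verma_relations j./2.
by rewrite -exprS even_halfK.
Qed.

Lemma verma_T2_odd j : odd j -> T2 *m v j =
  - (k2 * (1 - k2 ^- 2 * (Q / q ^+ j)^-1) * (1 - Q / q ^+ j)) *: v j.-1
  + (k2 + k2^-1 - k2 * (Q / q ^+ j)) *: v j.
Proof.
move=> jo; have [[_ _ _ +] _] := verma_relations j./2.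
by rewrite -exprS -odd_doubleS // odd_halfK.
Qed.

Lemma verma_T3_even j : ~~ odd j -> T3 *m v j = k3 *: v j.
Proof.
by move=> je; have [_ + _ _] := verma_invariant j./2; rewrite even_halfK.
Qed.

Lemma verma_T3_odd j : odd j -> T3 *m v j =
  - (k3^-1 * (1 - k2 ^- 2 * (Q / q ^+ j)^-1) * (1 - (Q / q ^+ j)^-1)) *: v j.-1
  + k3^-1 *: v j + k3 *: v j.+1.
Proof.
move=> jo; have [_ [_ +]] := verma_relations j./2.
by rewrite -exprS -odd_doubleS // odd_halfK.
Qed.

End Sequence.
End Verma.

(** * Subrepresentations and Verma sequences *)

Lemma ord4_ind (P : 'I_4 -> Prop) : P ix0 -> P ix1 -> P ix2 -> P ix3 ->
  forall i, P i.
Proof.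
move=> P0 P1 P2 P3 [[|[|[|[|//]]]] lt]; by rewrite (bool_irrelevance lt isT).
Qed.

Section Subrepresentations.
Variables (F : fieldType) (n : nat).
Implicit Types (T : 'I_4 -> 'M[F]_n) (S G : 'cV[F]_n -> Prop).

(** Operators satisfying the defining relations, the central elements t_i +
    t_i^-1 acting as the scalars c_i. *)
Record daha_mx (q : F) (c : 'I_4 -> F) T : Prop := DahaMx {
  daha_mx_quad : forall i, quadratic (c i) (T i);
  daha_mx_prod : T ix0 *m T ix1 *m T ix2 *m T ix3 = q^-1%:M }.

Record subrep T S : Prop := Subrep {
  subrep0 : S 0;
  subrepP : forall a u w, S u -> S w -> S (a *: u + w);
  subrep_act : forall i u, S u -> S (T i *m u) }.

(** The zero representation counts as simple. *)
Definition simple_rep T := forall S, subrep T S ->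
  (forall u, S u -> u = 0) \/ (forall u, S u).

Lemma subrepZ T S a u : subrep T S -> S u -> S (a *: u).
Proof. by case=> S0 SP _ Su; rewrite -[_ *: _]addr0; apply: SP. Qed.
Lemma subrepD T S u w : subrep T S -> S u -> S w -> S (u + w).
Proof. by case=> S0 SP _ Su Sw; rewrite -[u]scale1r; apply: SP. Qed.
Lemma subrep_sum T S I (r : seq I) (P : pred I) (f : I -> 'cV[F]_n) :
  subrep T S -> (forall i, P i -> S (f i)) -> S (\sum_(i <- r | P i) f i).
Proof.
move=> sS Sf; apply: big_ind => //; first exact: subrep0 sS.
by move=> u w; apply: subrepD sS.
Qed.

Inductive span_of G : 'cV[F]_n -> Prop :=
| span_of0 : span_of G 0
| span_ofP a g u : G g -> span_of G u -> span_of G (a *: g + u).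

Lemma span_of_gen G g : G g -> span_of G g.
Proof.
by move=> Gg; rewrite -[g]scale1r -[_ *: _]addr0; apply: span_ofP => //; left.
Qed.

Lemma span_of_lin G a u w : span_of G u -> span_of G w -> span_of G (a *: u + w).
Proof.
move=> Gu Gw; elim: Gu => [|b g x Gg _ IH]; first by rewrite scaler0 add0r.
by rewrite scalerDr scalerA -addrA; apply: span_ofP.
Qed.

Lemma span_of_subrep T G :
  (forall i g, G g -> span_of G (T i *m g)) -> subrep T (span_of G).
Proof.
move=> TG; split; [exact: span_of0 | exact: span_of_lin |].
move=> i u; elim=> [|a g w Gg _ IH]; first by rewrite mulmx0; exact: span_of0.
by rewrite mulmxDr -scalemxAr; apply: span_of_lin => //; apply: TG.
Qed.

Lemma span_of_ker m G (f : 'M[F]_(m, n)) u :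
  (forall g, G g -> f *m g = 0) -> span_of G u -> f *m u = 0.
Proof.
move=> fG; elim=> [|a g w Gg _ IH]; first by rewrite mulmx0.
by rewrite mulmxDr -scalemxAr (fG g) // IH scaler0 addr0.
Qed.

End Subrepresentations.

Section VermaRep.
Variables (F : fieldType) (q : F) (n : nat) (T : 'I_4 -> 'M[F]_n).
Variable k : 4.-tuple F.
Local Notation k0 := (tnth k ix0).
Local Notation k1 := (tnth k ix1).
Local Notation k2 := (tnth k ix2).
Local Notation k3 := (tnth k ix3).
Local Notation Q := (k0 * k1 * k2 * k3)^-1.
Hypotheses (q0 : q != 0) (kn0 : forall i, tnth k i != 0).
Hypothesis Tq : daha_mx q (fun i => tnth k i + (tnth k i)^-1) T.
Variable v0 : 'cV[F]_n.
Hypotheses (T0v0 : T ix0 *m v0 = k0 *: v0) (T3v0 : T ix3 *m v0 = k3 *: v0).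

Definition verma_rep := verma q (T ix0) (T ix1) k0 k1 v0.
Local Notation v := verma_rep.

Ltac vlem L := apply: (L F q n (T ix0) (T ix1) (T ix2) (T ix3) k0 k1 k2 k3) => //;
  first [exact: (daha_mx_quad Tq) | exact: (daha_mx_prod Tq) | idtac].

Let T0e j : ~~ odd j -> T ix0 *m v j =
  (k0^-1 * q ^- j * (1 - q ^+ j) * (1 - k0 ^+ 2 * q ^+ j)) *: v j.-1
  + (k0 + k0^-1 - k0^-1 * q ^- j) *: v j.
Proof. by vlem verma_T0_even. Qed.
Let T0o j : odd j ->
  T ix0 *m v j = (k0^-1 * q ^- j.+1) *: (v j - v j.+1).
Proof. by vlem verma_T0_odd. Qed.
Let T1e j : ~~ odd j -> T ix1 *m v j =
  - (k1 * (1 - q ^+ j) * (1 - k0 ^+ 2 * q ^+ j)) *: v j.-1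
  + k1 *: v j + k1^-1 *: v j.+1.
Proof. by vlem verma_T1_even. Qed.
Let T1o j : odd j -> T ix1 *m v j = k1^-1 *: v j.
Proof. by vlem verma_T1_odd. Qed.
Let T2e j : ~~ odd j ->
  T ix2 *m v j = (k2 * (Q / q ^+ j.+1)) *: (v j - v j.+1).
Proof. by vlem verma_T2_even. Qed.
Let T2o j : odd j -> T ix2 *m v j =
  - (k2 * (1 - k2 ^- 2 * (Q / q ^+ j)^-1) * (1 - Q / q ^+ j)) *: v j.-1
  + (k2 + k2^-1 - k2 * (Q / q ^+ j)) *: v j.
Proof. by vlem verma_T2_odd. Qed.
Let T3e j : ~~ odd j -> T ix3 *m v j = k3 *: v j.
Proof. by vlem verma_T3_even. Qed.
Let T3o j : odd j -> T ix3 *m v j =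
  - (k3^-1 * (1 - k2 ^- 2 * (Q / q ^+ j)^-1) * (1 - (Q / q ^+ j)^-1)) *: v j.-1
  + k3^-1 *: v j + k3 *: v j.+1.
Proof. by vlem verma_T3_odd. Qed.

Let Qj0 j : Q / q ^+ j != 0.
Proof. by rewrite mulf_neq0 ?invr_neq0 ?expf_neq0 // !mulf_neq0. Qed.

Definition verma_tail b (x : 'cV[F]_n) := exists2 j, (b <= j)%N & x = v j.

(** Only T_i v_b can leave the span of v_b, v_{b+1}, ..., through v_{b-1}; its
    coefficients there vanish together with the products given here. *)
Lemma verma_tail_subrep b :
  (~~ odd b -> (1 - q ^+ b) * (1 - k0 ^+ 2 * q ^+ b) = 0) ->
  (odd b -> (1 - k2 ^- 2 * (Q / q ^+ b)^-1) * (1 - Q / q ^+ b) = 0) ->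
  subrep T (span_of (verma_tail b)).
Proof.
move=> be bo; apply: span_of_subrep => i _ [j bj ->].
have sA u w : span_of (verma_tail b) u -> span_of (verma_tail b) w ->
    span_of (verma_tail b) (u + w).
  by move=> su sw; rewrite -[u]scale1r; apply: span_of_lin.
have sZ a u : span_of (verma_tail b) u -> span_of (verma_tail b) (a *: u).
  by move=> su; rewrite -[_ *: _]addr0; apply: span_of_lin => //; left.
have sv a l : (b <= l)%N -> span_of (verma_tail b) (a *: v l).
  by move=> bl; apply/sZ/span_of_gen; exists l.
have sN a l : (b <= l)%N -> span_of (verma_tail b) (a *: (v l - v l.+1)).
  move=> bl; rewrite scalerBr -scaleNr; apply: sA; apply: sv => //.
  exact: leqW.
have sp a : (j = b -> a = 0) -> span_of (verma_tail b) (a *: v j.-1).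
  have [jb /(_ jb) ->|/eqP jb _] := eqVneq j b; first by rewrite scale0r; left.
  by apply: sv; move: bj jb; case: (j) => [|j'] /=; lia.
have bj1 := leqW bj.
case: (boolP (odd j)) => [jo|je]; elim/ord4_ind: i.
- by rewrite T0o //; apply: sN.
- by rewrite T1o //; apply: sv.
- rewrite T2o //; apply: (sA); last exact: sv.
  by apply: sp => jb; rewrite -mulrA jb bo -?jb // mulr0 oppr0.
- rewrite T3o //; apply: (sA); last exact: sv.
  apply: (sA); last exact: sv.
  apply: sp => jb; have := bo; rewrite -jb => /(_ jo)/eqP.
  rewrite mulf_eq0 => /orP[/eqP ->|]; first by rewrite mulr0 mul0r oppr0.
  by rewrite subr_eq0 => /eqP <-; rewrite invr1 subrr mulr0 oppr0.
- rewrite T0e //; apply: (sA); last exact: sv.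
  by apply: sp => jb; rewrite -mulrA jb be -?jb // mulr0.
- rewrite T1e //; apply: (sA); last exact: sv.
  apply: (sA); last exact: sv.
  by apply: sp => jb; rewrite -mulrA jb be -?jb // mulr0 oppr0.
- by rewrite T2e //; apply: sN.
- by rewrite T3e //; apply: sv.
Qed.

Section LeftEigenvector.
Variable f : 'rV[F]_n.
Hypotheses (fT1 : f *m T ix1 = k1 *: f) (fT2 : f *m T ix2 = k2 *: f).

(** Applying f to T_1 v_i for i even gives f(v_{i+1}) as a multiple of
    f(v_{i-1}). *)
Lemma left_verma_odd j : odd j -> f *m v j = 0.
Proof.
move=> jo; rewrite (odd_doubleS jo); elim: (j./2) => [|h IH] /=;
  [set i := 0%N | set i := h.+1.*2]; have ie : ~~ odd i by rewrite /i ?odd_double.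
all: have := congr1 (mulmx f) (T1e ie); rewrite mulmxA fT1 -scalemxAl.
all: rewrite !mulmxDr -!scalemxAr.
  rewrite /i expr0 subrr mulr0 mul0r oppr0 scale0r add0r => /eqP.
  rewrite -subr_eq0 opprD addNKr oppr_eq0 scaler_eq0 invr_eq0.
  by rewrite (negPf (kn0 _)) => /eqP.
rewrite /i doubleS /= IH scaler0 add0r => /eqP.
rewrite -subr_eq0 opprD addNKr oppr_eq0 scaler_eq0 invr_eq0.
by rewrite (negPf (kn0 _)) => /eqP.
Qed.

(** Applying f to T_2 v_j. When the powers of q are distinct, at most one v_j
    is not killed by f: this detects the truncation point of the sequence. *)
Lemma left_verma_even j : f *m v j != 0 -> ~~ odd j /\ Q = q ^+ j.+1.
Proof.
case: (boolP (odd j)) => [jo|je]; first by rewrite left_verma_odd // eqxx.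
move=> fj; split=> //.
have := congr1 (mulmx f) (T2e je); rewrite mulmxA fT2 -scalemxAl.
rewrite -scalemxAr mulmxBr (@left_verma_odd j.+1) ?subr0; last by rewrite /= je.
move/eqP; rewrite -subr_eq0 -scalerBl scaler_eq0 (negPf fj) orbF subr_eq0.
rewrite -[X in X == _]mulr1 => /eqP/(mulfI (kn0 _))/esym/divr1_eq.
by [].
Qed.

End LeftEigenvector.

Section Intertwine.
Variable e : nat.
Hypotheses (e_even : ~~ odd e) (QE : Q = q ^+ e.+1) (ve : v e.+1 = 0).

Definition verma_mx : 'M[F]_(n, e.+1) := \matrix_(l, j) v j l 0.

Lemma mul_verma_mx j : (j <= e.+1)%N -> verma_mx *m Ov F e j = v j.
Proof.
rewrite leq_eqVlt => /orP[/eqP ->|je]; first by rewrite Ov_out // mulmx0 ve.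
apply/matrixP=> l c; rewrite ord1 !mxE (bigD1 (Ordinal je)) //= !mxE eqxx mulr1.
rewrite big1 ?addr0 // => i; rewrite -(inj_eq val_inj) /= !mxE => /negPf ->.
by rewrite mulr0.
Qed.

Lemma eq_mx_Ov m (A B : 'M[F]_(m, e.+1)) :
  (forall j, (j <= e)%N -> A *m Ov F e j = B *m Ov F e j) -> A = B.
Proof.
move=> AB; apply/matrixP=> i j; have /matrixP/(_ i 0) := AB j (leq_ord j).
have col (C : 'M[F]_(m, e.+1)) : (C *m Ov F e j) i 0 = C i j.
  rewrite !mxE (bigD1 j) //= !mxE eqxx mulr1 big1 ?addr0 // => l lj.
  by rewrite !mxE -[_ == _ :> nat]/(l == j) (negPf lj) mulr0.
by rewrite !col.
Qed.

Lemma verma_mx_intertwines i : T i *m verma_mx = verma_mx *m Ogen q e k i.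
Proof.
apply: eq_mx_Ov => j je; rewrite -!mulmxA mul_verma_mx ?leqW //.
have jp : (j.-1 <= e.+1)%N by lia.
have M := mul_verma_mx; have je1 := leqW je.
case: (boolP (odd j)) => [jo|jev]; elim/ord4_ind: i; rewrite /Ogen /=.
- by rewrite T0o // T0_odd // -scalemxAr mulmxBr !M.
- by rewrite T1o // T1_odd // -scalemxAr !M.
- by rewrite T2o // T2_odd // mulmxDr -!scalemxAr !M // QE.
- by rewrite T3o // T3_odd // !mulmxDr -!scalemxAr !M // QE.
- by rewrite T0e // T0_even // mulmxDr -!scalemxAr !M.
- by rewrite T1e // T1_even // !mulmxDr -!scalemxAr !M.
- by rewrite T2e // T2_even // -!scalemxAr mulmxBr !M // QE.
- by rewrite T3e // T3_even // -!scalemxAr !M.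
Qed.

End Intertwine.
End VermaRep.

(** * Recurrences satisfied by common eigenvectors *)

Lemma linear_combination (R : pzRingType) (c x y x' y' : R) :
  x = y -> x' - y' = c * (x - y) -> x' = y'.
Proof. by move=> ->; rewrite subrr mulr0 => /subr0_eq. Qed.

(* Dropping the field hypotheses keeps the preprocessing of lia fast. *)
Ltac nlia := match goal with K : fieldType |- _ => clear dependent K end; lia.

Section Recurrences.
Variables (F : fieldType) (q : F) (d : nat).
Hypotheses (q0 : q != 0) (q_not_root : forall n, (0 < n)%N -> q ^+ n != 1).
Hypothesis d_even : ~~ odd d.

(** The condition of OP_d on one of the four parameters. *)
Definition generic_at (x : F) :=
  forall i, (2 <= i <= d)%N -> ~~ odd i -> x ^+ 2 != q ^- i.

Lemma generic_neq (x : F) i : x != 0 -> generic_at x -> (2 <= i <= d)%N ->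
  ~~ odd i -> 1 - x ^+ 2 * q ^+ i != 0.
Proof.
move=> x0 gx id ie; apply: contra (gx i id ie); rewrite subr_eq0 => /eqP E.
by apply/eqP/(mulIf (expf_neq0 i q0)); rewrite -E mulVf // expf_neq0.
Qed.

Lemma generic_neqV (x : F) i : x != 0 -> generic_at x -> (2 <= i <= d)%N ->
  ~~ odd i -> 1 - x ^- 2 * (q ^+ i)^-1 != 0.
Proof.
move=> x0 gx id ie; apply: contra (gx i id ie); rewrite subr_eq0 => /eqP E.
by apply/eqP/(mulfI (invr_neq0 (expf_neq0 2 x0))); rewrite -E mulVf // expf_neq0.
Qed.

Lemma eq_or_inv (x l : F) : x != 0 -> l != 0 -> l + l^-1 = x + x^-1 ->
  l = x \/ l = x^-1.
Proof.
move=> x0 l0 E; have : (l - x) * (l - x^-1) = 0.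
  have -> : (l - x) * (l - x^-1) = l * (l + l^-1) - l * (x + x^-1).
    by field; rewrite x0 l0.
  by rewrite E subrr.
by move/eqP; rewrite mulf_eq0 !subr_eq0 => /orP[] /eqP; auto.
Qed.

(** ** Coordinates of a common eigenvector of t_0 and t_3 *)

Section RightEigenvector.
Variables (k0 k2 k3 l0 l3 : F) (a : nat -> F).
Hypotheses (k00 : k0 != 0) (k20 : k2 != 0) (k30 : k3 != 0).
Hypotheses (g0 : generic_at k0) (g2 : generic_at k2) (g3 : generic_at k3).
Hypothesis l0E : l0 = k0 \/ l0 = k0^-1.
Hypothesis a_out : forall j, (d < j)%N -> a j = 0.
Local Notation g j :=
  ((1 - k2 ^- 2 * (q ^+ d.+1 / q ^+ j)^-1) * (1 - (q ^+ d.+1 / q ^+ j)^-1)).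
Hypothesis T0_0 : l0 * a 0 = k0 * a 0.
Hypothesis T0_e : forall j, (0 < j <= d)%N -> ~~ odd j ->
  l0 * a j = - (k0^-1 * q ^- j) * a j.-1 + (k0 + k0^-1 - k0^-1 * q ^- j) * a j.
Hypothesis T0_o : forall j, (j <= d)%N -> odd j ->
  l0 * a j = k0^-1 * q ^- j.+1 * (a j + (1 - q ^+ j.+1) * (1 - k0 ^+ 2 * q ^+ j.+1) * a j.+1).
Hypothesis T3_o : forall j, (j <= d)%N -> odd j -> l3 * a j = k3^-1 * a j.
Hypothesis T3_e : forall j, (0 < j <= d)%N -> ~~ odd j ->
  l3 * a j = k3 * a j + k3 * a j.-1 - k3^-1 * g j.+1 * a j.+1.
Hypothesis T3_0 : l3 * a 0 = k3 * a 0 - k3^-1 * g 1 * a 1.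

Lemma expf_ratio j : (j <= d.+1)%N -> q ^+ d.+1 / q ^+ j = q ^+ (d.+1 - j).
Proof. by move=> jd; rewrite expfB_cond // (negPf q0). Qed.

Lemma right_coef_neq0 j : odd j -> (j <= d)%N -> g j != 0.
Proof.
move=> jo jd; have id : (2 <= d.+1 - j <= d)%N by nlia.
have ie : ~~ odd (d.+1 - j) by nlia.
rewrite expf_ratio; last by nlia.
rewrite mulf_neq0 ?generic_neqV // subr_eq0 eq_sym invr_eq1.
by apply: q_not_root; nlia.
Qed.

(** Let a_m be the last nonzero coordinate and suppose m > 0. The rows of t_0
    force m even and a_{m-1} <> 0; then l3 = k3^-1, and comparing the two
    expressions of a_{m-1} excludes l0 = k0 because k3^2 <> q^-m, so that k0^2
    k3^2 q^m = 1. Descending, no coordinate of even index up to m vanishes, as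
    k0 and k2 are generic; at index 0 this yields k0^2 = 1, hence again k3^2 =
    q^-m. *)
Lemma right_eigen_eq0 j : (0 < j)%N -> a j = 0.
Proof.
move=> j0; apply/eqP/negPn/negP => aj.
have [m /andP[m0 am] mmax] : {m | (0 < m)%N && (a m != 0) &
    forall i, (0 < i)%N && (a i != 0) -> (i <= m)%N}.
  have ex : exists m, (0 < m)%N && (a m != 0) by exists j; rewrite j0.
  have ub i : (0 < i)%N && (a i != 0) -> (i <= d)%N.
    by case/andP=> _; rewrite leqNgt; apply: contra => /a_out ->.
  by case: (ex_maxnP ex ub) => m Pm Um; exists m.
have md : (m <= d)%N by rewrite leqNgt; apply: contra am => /a_out ->.
have top i : (m < i)%N -> a i = 0.
  move=> mi; apply/eqP/negPn/negP => ai.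
  by have := mmax i; rewrite ai (leq_ltn_trans _ mi) // leqNgt mi => /(_ isT).
have me : ~~ odd m.
  apply/negP=> mo; have md1 : (0 < m.+1 <= d)%N by nlia.
  have := T0_e md1; rewrite /= negbK mo => /(_ isT).
  rewrite (top m.+1) // !mulr0 addr0 => /esym/eqP.
  by rewrite mulf_eq0 (negPf am) orbF oppr_eq0 mulf_eq0 !invr_eq0
    (negPf k00) expf_eq0 (negPf q0) andbF.
have qn i : q ^+ i != 0 by rewrite expf_neq0.
have m2 : (2 <= m <= d)%N by move: (m) m0 me md => [|[|]].
have qm1 i : (0 < i)%N -> 1 - q ^+ i != 0.
  by move=> i0; rewrite subr_eq0 eq_sym q_not_root.
have step i : (2 <= i <= d)%N -> ~~ odd i -> a i != 0 -> a i.-1 != 0.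
  move=> id ie; apply: contraNneq => ai1.
  have iP : (i.-1).+1 = i by nlia.
  have io : odd i.-1 by nlia.
  have := T0_o _ io; rewrite iP ai1 mulr0 add0r => /(_ ltac:(nlia))/esym/eqP.
  rewrite !mulf_eq0 !invr_eq0 (negPf k00) (negPf (qn i)) /=.
  rewrite (negPf (generic_neq k00 g0 id ie)) (negPf (qm1 i _)) //; nlia.
have am1 := step m m2 me am.
have mP : (m.-1).+1 = m by nlia.
have mo : odd m.-1 by nlia.
have l3E : l3 = k3^-1.
  by apply: (mulIf am1); rewrite T3_o //; nlia.
have am1E : a m.-1 = (k3 ^- 2 - 1) * a m.
  have := T3_e (j := m); rewrite m0 md me (top m.+1) // mulr0 subr0 l3E.
  move=> /(_ isT isT) E; apply: (linear_combination (c := - k3^-1) E).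
  by field.
have := T0_e (j := m); rewrite m0 md me am1E => /(_ isT isT) E.
have qk3 : k3 ^+ 2 != q ^- m by apply: g3.
case: l0E => l0E'.
  have : (k3 ^+ 2 * q ^+ m - 1) * a m = 0.
    rewrite l0E' in E; apply: (linear_combination (c := - k3 ^+ 2 * k0 * q ^+ m) E).
    by field; rewrite k00 qn k30.
  move/eqP; rewrite mulf_eq0 (negPf am) orbF subr_eq0 => /eqP E3.
  by case/eqP: qk3; apply: (mulIf (qn m)); rewrite E3 mulVf.
have kk : k0 ^+ 2 * k3 ^+ 2 * q ^+ m = 1.
  apply/(mulIf am)/eqP; rewrite -subr_eq0; apply/eqP.
  rewrite l0E' in E; apply: (linear_combination (c := - k3 ^+ 2 * k0 * q ^+ m) E).
  by field; rewrite k00 qn k30.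
have prev i : (2 <= i <= d)%N -> ~~ odd i -> a i.-1 = (k0 ^+ 2 * q ^+ i - 1) * a i.
  move=> id ie; have := T0_e _ ie; rewrite l0E' => /(_ ltac:(nlia)) E'.
  apply: (linear_combination (c := k0 * q ^+ i) E').
  by field; rewrite k00 qn.
have chain h : (h.*2 <= m)%N -> a (m - h.*2)%N != 0.
  elim: h => [|h IH] hm; first by rewrite subn0.
  have {}IH := IH ltac:(nlia).
  set i := (m - h.*2)%N in IH; have iE : (m - h.+1.*2)%N = i.-2 by nlia.
  rewrite iE; have ie : ~~ odd i by nlia.
  have id : (2 <= i <= d)%N by nlia.
  have ai1 := step i id ie IH.
  have i1E : i.-2.+1 = i.-1 by nlia.
  have gn := @right_coef_neq0 i.-1 ltac:(nlia) ltac:(nlia).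
  case: (leqP i 2) => i2.
    have i_2 : i = 2%N by nlia.
    rewrite i_2 /=; apply: contraNneq ai1 => a00; have := T3_0.
    rewrite a00 !mulr0 sub0r => /esym/eqP; rewrite oppr_eq0 -mulrA mulf_eq0.
    rewrite invr_eq0 (negPf k30) /= mulf_eq0; rewrite i_2 /= in gn *.
    by rewrite (negPf gn).
  have e2 : ~~ odd i.-2 by nlia.
  have := T3_e _ e2; rewrite l3E i1E => /(_ ltac:(nlia)) E'.
  apply: contraNneq ai1 => ai2.
  have p2 : a i.-2.-1 = 0 by rewrite prev ?ai2 ?mulr0 //; nlia.
  move: E'; rewrite ai2 p2 !mulr0 !add0r => /esym/eqP.
  by rewrite oppr_eq0 -mulrA mulf_eq0 invr_eq0 (negPf k30) /= mulf_eq0 (negPf gn).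
have a0 : a 0 != 0 by have := chain m./2; rewrite even_halfK // subnn; exact.
have k02 : k0 ^+ 2 = 1.
  have := mulIf a0 T0_0; rewrite l0E' => E'.
  by rewrite expr2 -{2}E' mulfV.
case/eqP: qk3; apply: (mulIf (qn m)); rewrite mulVf //.
by rewrite -kk k02 mul1r.
Qed.
End RightEigenvector.

(** ** Values of a common left eigenvector of t_1 and t_2 *)

Section LeftEigenvector.
Variables (k0 k1 k2 l1 l2 : F) (f : nat -> F).
Hypotheses (k00 : k0 != 0) (k10 : k1 != 0) (k20 : k2 != 0).
Hypotheses (g0 : generic_at k0) (g1 : generic_at k1) (g2 : generic_at k2).
Hypotheses (l1E : l1 = k1 \/ l1 = k1^-1) (l2E : l2 = k2 \/ l2 = k2^-1).
Hypothesis f_out : forall j, (d < j)%N -> f j = 0.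
Hypothesis T1_e : forall j, (j <= d)%N -> ~~ odd j ->
  l1 * f j = - (k1 * (1 - q ^+ j) * (1 - k0 ^+ 2 * q ^+ j)) * f j.-1
             + k1 * f j + k1^-1 * f j.+1.
Hypothesis T2_e : forall j, (j <= d)%N -> ~~ odd j ->
  l2 * f j = k2 * (q ^+ d.+1 / q ^+ j.+1) * (f j - f j.+1).

(** Same pattern, read upwards from the first nonzero value f_m, if m < d: m is
    even, l1 = k1 is excluded by q^{d-m} <> 1 and k2^2 <> q^{m-d}, and l1 =
    k1^-1, l2 = k2 by k1^2 <> q^{m-d}. There remains l2 = k2^-1 with k1^2 k2^2 =
    q^{m-d}; then no f_{m+2h} vanishes, as k0 and k2 are generic, and f_d <> 0
    forces k2^2 = 1, against the condition on k1. *)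
Lemma left_eigen_eq0 j : (j < d)%N -> f j = 0.
Proof.
move=> jd; apply/eqP/negPn/negP => fj.
have ex : exists m, f m != 0 by exists j.
have [m fm mmin] := ex_minnP ex.
have md : (m < d)%N by apply: leq_ltn_trans (mmin j fj) jd.
have bot i : (i < m)%N -> f i = 0.
  by move=> im; apply/eqP/negPn/negP => /mmin; rewrite leqNgt im.
have qn i : q ^+ i != 0 by rewrite expf_neq0.
have me : ~~ odd m.
  apply/negP=> mo; have mP : m.-1.+1 = m by nlia.
  have := T2_e (j := m.-1); rewrite mP (bot m.-1); last by nlia.
  rewrite mulr0 sub0r => /(_ ltac:(nlia) ltac:(nlia))/esym/eqP.
  by rewrite !mulf_eq0 invr_eq0 oppr_eq0 (negPf k20) !(negPf (qn _)) (negPf fm).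
have fmS : f m.+1 = k1 * (l1 - k1) * f m.
  have := T1_e (j := m); case: (posnP m) => [m0|m0].
    rewrite m0 expr0 subrr mulr0 mul0r oppr0 mul0r add0r => E.
    by apply: (linear_combination (c := - k1) (E isT isT)); field.
  rewrite (bot m.-1) ?mulr0 ?add0r; last by nlia.
  move=> /(_ (ltnW md) me) E.
  by apply: (linear_combination (c := - k1) E); field.
have ratio i : (i < d)%N -> q ^+ d.+1 / q ^+ i.+1 = q ^+ (d - i).
  by move=> id; rewrite expf_ratio // ltnW.
have next i : (i < d)%N -> ~~ odd i ->
    f i.+1 = (1 - l2 * k2^-1 * q ^- (d - i)) * f i.
  move=> id ie; have := T2_e (ltnW id) ie; rewrite ratio // => E.
  apply: (linear_combination (c := k2^-1 * q ^- (d - i)) E).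
  by field; rewrite qn k20.
have dm : (2 <= d - m <= d)%N by nlia.
have dme : ~~ odd (d - m) by nlia.
have key : k1 * (l1 - k1) = 1 - l2 * k2^-1 * q ^- (d - m).
  by apply: (mulIf fm); rewrite -fmS next.
have q1 : q ^+ (d - m) != 1 by apply: q_not_root; nlia.
have gVE (x : F) : x ^+ 2 * q ^+ (d - m) = 1 -> x ^+ 2 = q ^- (d - m).
  by move=> E; apply: (mulIf (qn (d - m)%N)); rewrite E mulVf.
case: l1E => l1E'.
  have : l2 = k2 * q ^+ (d - m).
    apply: (linear_combination (c := k2 * q ^+ (d - m)) key).
    by rewrite l1E'; field; rewrite qn k20.
  case: l2E => -> E.
    by case/eqP: q1; apply: (mulfI k20); rewrite -E mulr1.
  have /eqP[] := g2 dm dme; apply: gVE.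
  by rewrite expr2 -mulrA -E mulfV.
have kk : l2 = k1 ^+ 2 * k2 * q ^+ (d - m).
  apply: (linear_combination (c := k2 * q ^+ (d - m)) key).
  by rewrite l1E'; field; rewrite qn k20 k10.
have nk1 : k1 ^+ 2 * q ^+ (d - m) != 1.
  by apply: contra (g1 dm dme) => /eqP/gVE ->.
have l2E' : l2 = k2^-1.
  case: l2E => // E; case/eqP: nk1; apply: (mulIf k20).
  by rewrite mulrAC -kk E mul1r.
have step i : (i < d)%N -> ~~ odd i -> f i != 0 -> f i.+1 != 0.
  move=> id ie fi; rewrite next // l2E' mulf_neq0 //.
  rewrite -expr2 exprVn generic_neqV //; nlia.
have chain h : (m + h.*2 <= d)%N -> f (m + h.*2)%N != 0.
  elim: h => [|h IH] hm; first by rewrite addn0.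
  have {}IH := IH ltac:(nlia).
  set i := (m + h.*2)%N in IH; have iE : (m + h.+1.*2)%N = i.+2 by nlia.
  rewrite iE; have ie : ~~ odd i by nlia.
  have id : (i.+2 <= d)%N by nlia.
  have fi1 := step i ltac:(nlia) ie IH.
  have ie2 : ~~ odd i.+2 by rewrite /= negbK.
  apply: contraNneq fi1 => fi2.
  have fi3 : f i.+3 = 0.
    move: id; rewrite leq_eqVlt => /orP[/eqP idE|id]; last by rewrite next // fi2 mulr0.
    by apply: f_out; nlia.
  have := T1_e id ie2; rewrite fi2 fi3 !mulr0 !addr0 => /esym/eqP.
  rewrite mulf_eq0 oppr_eq0 !mulf_eq0 (negPf k10) /=.
  rewrite (negPf (generic_neq k00 g0 _ ie2)) ?id // orbF subr_eq0 eq_sym.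
  by rewrite (negPf (q_not_root _)).
have fd : f d != 0.
  have := chain (d - m)./2; rewrite even_halfK // subnKC; last by nlia.
  exact.
have := T2_e (leqnn d) d_even; rewrite (f_out (ltnSn d)) subr0 divff //.
rewrite mulr1 => /(mulIf fd) E; case/eqP: nk1.
by apply: (mulIf k20); rewrite mulrAC -kk E mul1r.
Qed.
End LeftEigenvector.
End Recurrences.

(** * The matrices of O(k) *)

(** A row space of maximal rank inside S. Dimensions of subspaces given as
    predicates become ranks of matrices. *)
Lemma subspace_mx (F : fieldType) n (S : 'cV[F]_n -> Prop) :
  S 0 -> (forall a u w, S u -> S w -> S (a *: u + w)) ->
  exists M : 'M[F]_n, forall x, S x <-> (x^T <= M)%MS.
Proof.
move=> S0 SP; pose inS (M : 'M[F]_n) := forall u : 'rV_n, (u <= M)%MS -> S u^T.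
pose P r := `[< exists2 M, inS M & \rank M = r >].
have ex : exists r, P r.
  exists 0%N; apply/asboolP; exists 0; last exact: mxrank0.
  by move=> u; rewrite submx0 => /eqP ->; rewrite trmx0.
have ub r : P r -> (r <= n)%N by move/asboolP=> [M _ <-]; apply: rank_leq_row.
case: (ex_maxnP ex ub) => r /asboolP[M MS Mr] rmax.
exists M => x; split=> [Sx|/MS]; last by rewrite trmxK.
have : (\rank (M + x^T)%MS <= \rank M)%N.
  rewrite Mr; apply: rmax; apply/asboolP; exists (M + x^T)%MS => //.
  move=> u /sub_addsmxP[[a b] /= ->]; rewrite linearD /= addrC.
  rewrite [b]mx11_scalar mul_scalar_mx linearZ /= trmxK.
  by apply: SP => //; apply: MS; apply: submxMl.
rewrite (geq_leqif (mxrank_leqif_sup (addsmxSl M x^T))).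
exact/submx_trans/addsmxSr.
Qed.

Section OMatrices.
Variables (F : fieldType) (q : F) (q0 : q != 0) (d : nat) (d_even : ~~ odd d).
Variable k : 4.-tuple F.
Hypothesis kn0 : forall i, tnth k i != 0.
Hypothesis kP : \prod_(i < 4) tnth k i = q ^- d.+1.
Local Notation k0 := (tnth k ix0).
Local Notation k1 := (tnth k ix1).
Local Notation k2 := (tnth k ix2).
Local Notation k3 := (tnth k ix3).
Local Notation Q := (q ^+ d.+1).
Local Notation T := (Ogen q d k).
Local Notation v := (Ov F d).
Local Notation r j := (v j)^T.

Lemma quadratic_of_inverse n (c : F) (A : 'M[F]_n) :
  A *m (c%:M - A) = 1%:M -> quadratic c A.
Proof. by rewrite mulmxBr mul_mx_scalar /quadratic => <-; rewrite subKr. Qed.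

Lemma Ogen_daha_mx : daha_mx q (fun i => tnth k i + (tnth k i)^-1) T.
Proof.
split.
  by move=> i; apply: quadratic_of_inverse; elim/ord4_ind: i;
    [exact: quad0|exact: quad1|exact: quad2|exact: quad3].
have kp : [forall i, tnth k i != 0] && (\prod_(i < 4) tnth k i == q ^- d.+1).
  by apply/andP; split; [apply/forallP | apply/eqP].
by have := daha_relP (O_rel q0 d_even (exist _ k kp)); rewrite scalemx1.
Qed.

Lemma OT0_even j : ~~ odd j -> (j <= d)%N -> T ix0 *m v j =
  (k0^-1 * q ^- j * (1 - q ^+ j) * (1 - k0 ^+ 2 * q ^+ j)) *: v j.-1
  + (k0 + k0^-1 - k0^-1 * q ^- j) *: v j.
Proof. exact: T0_even. Qed.
Lemma OT0_odd j : odd j -> (j <= d)%N -> T ix0 *m v j =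
  (k0^-1 * q ^- j.+1) *: (v j - v j.+1).
Proof. by move=> ? /leqW; exact: T0_odd. Qed.
Lemma OT1_even j : ~~ odd j -> (j <= d)%N -> T ix1 *m v j =
  - (k1 * (1 - q ^+ j) * (1 - k0 ^+ 2 * q ^+ j)) *: v j.-1
  + k1 *: v j + k1^-1 *: v j.+1.
Proof. exact: T1_even. Qed.
Lemma OT1_odd j : odd j -> (j <= d)%N -> T ix1 *m v j = k1^-1 *: v j.
Proof. by move=> ? /leqW; exact: T1_odd. Qed.
Lemma OT2_even j : ~~ odd j -> (j <= d)%N -> T ix2 *m v j =
  (k2 * (Q / q ^+ j.+1)) *: (v j - v j.+1).
Proof. exact: T2_even. Qed.
Lemma OT2_odd j : odd j -> (j <= d)%N -> T ix2 *m v j =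
  - (k2 * (1 - k2 ^- 2 * (Q / q ^+ j)^-1) * (1 - Q / q ^+ j)) *: v j.-1
  + (k2 + k2^-1 - k2 * (Q / q ^+ j)) *: v j.
Proof. by move=> ? /leqW; exact: T2_odd. Qed.
Lemma OT3_even j : ~~ odd j -> (j <= d)%N -> T ix3 *m v j = k3 *: v j.
Proof. exact: T3_even. Qed.
Lemma OT3_odd j : odd j -> (j <= d)%N -> T ix3 *m v j =
  - (k3^-1 * (1 - k2 ^- 2 * (Q / q ^+ j)^-1) * (1 - (Q / q ^+ j)^-1)) *: v j.-1
  + k3^-1 *: v j + k3 *: v j.+1.
Proof. by move=> ? /leqW; exact: T3_odd. Qed.

Lemma row_Ov j l : (j <= d)%N -> r j *m v l = (j == l)%:R%:M.
Proof.
move=> jd; apply/matrixP=> a b; rewrite !ord1 !mxE eqxx mulr1n.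
rewrite (bigD1 (Ordinal (jd : (j < d.+1)%N))) //= !mxE eqxx mul1r.
rewrite big1 ?addr0 // => i; rewrite -(inj_eq val_inj) /= !mxE => /negPf ->.
by rewrite mul0r.
Qed.

Lemma row_Ov_out j l : (d < j)%N -> r j *m v l = 0.
Proof. by move=> dj; rewrite Ov_out // trmx0 mul0mx. Qed.

Ltac row_entry := apply/matrixP=> ? ?; rewrite !ord1 !mxE ?eqxx ?mulr1n.

Lemma row_T0_even j : (0 < j <= d)%N -> ~~ odd j -> r j *m T ix0 =
  - (k0^-1 * q ^- j) *: r j.-1 + (k0 + k0^-1 - k0^-1 * q ^- j) *: r j.
Proof.
move=> /andP[j0 jd] je; apply: eq_mx_Ov => l ld; rewrite -mulmxA mulmxDl -!scalemxAl.
have j1d : (j.-1 <= d)%N by nlia.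
rewrite !row_Ov //.
case: (boolP (odd l)) => lo.
  rewrite OT0_odd // -scalemxAr mulmxBr !row_Ov //.
  have -> : (j == l) = false by nlia.
  have -> : (j == l.+1) = (j.-1 == l) by nlia.
  by row_entry; case: eqP => [<-|_]; rewrite ?prednK //=; ring.
rewrite OT0_even // mulmxDr -!scalemxAr !row_Ov //.
have -> : (j == l.-1) = false by nlia.
have -> : (j.-1 == l) = false by nlia.
by row_entry; case: eqP => [<-|_] /=; ring.
Qed.

Lemma row_T0_0 : r 0 *m T ix0 = k0 *: r 0.
Proof.
apply: eq_mx_Ov => l ld; rewrite -mulmxA -!scalemxAl !row_Ov //.
case: (boolP (odd l)) => lo.
  rewrite OT0_odd // -scalemxAr mulmxBr !row_Ov //.
  have -> : (0%N == l) = false by nlia.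
  by row_entry; rewrite /=; ring.
rewrite OT0_even // mulmxDr -!scalemxAr !row_Ov //.
case: l ld lo => [|l] ld lo.
  by row_entry; rewrite expr0 invr1 /=; ring.
have -> : (0%N == l.+1.-1) = false by nlia.
by row_entry; rewrite /=; ring.
Qed.

Lemma row_T0_odd j : (j <= d)%N -> odd j -> r j *m T ix0 =
  (k0^-1 * q ^- j.+1) *:
    (r j + ((1 - q ^+ j.+1) * (1 - k0 ^+ 2 * q ^+ j.+1)) *: r j.+1).
Proof.
move=> jd jo; have j1d : (j.+1 <= d)%N by nlia.
apply: eq_mx_Ov => l ld; rewrite -mulmxA -scalemxAl mulmxDl -!scalemxAl !row_Ov //.
case: (boolP (odd l)) => lo.
  rewrite OT0_odd // -scalemxAr mulmxBr !row_Ov //.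
  have -> : (j == l.+1) = false by nlia.
  have -> : (j.+1 == l) = false by nlia.
  by row_entry; case: eqP => [<-|_] /=; ring.
rewrite OT0_even // mulmxDr -!scalemxAr !row_Ov //.
have -> : (j == l) = false by nlia.
have -> : (j == l.-1) = (j.+1 == l) by nlia.
by row_entry; case: eqP => [<-|_] /=; ring.
Qed.

Lemma row_T2_odd j : (j <= d)%N -> odd j -> r j *m T ix2 =
  - (k2 * (Q / q ^+ j)) *: r j.-1 + (k2 + k2^-1 - k2 * (Q / q ^+ j)) *: r j.
Proof.
move=> jd jo; have j1d : (j.-1 <= d)%N by nlia.
apply: eq_mx_Ov => l ld; rewrite -mulmxA mulmxDl -!scalemxAl !row_Ov //.
case: (boolP (odd l)) => lo.
  rewrite OT2_odd // mulmxDr -!scalemxAr !row_Ov //.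
  have -> : (j == l.-1) = false by nlia.
  have -> : (j.-1 == l) = false by nlia.
  by row_entry; case: eqP => [<-|_] /=; ring.
rewrite OT2_even // -!scalemxAr mulmxBr !row_Ov //.
have -> : (j == l) = false by nlia.
have -> : (j == l.+1) = (j.-1 == l) by nlia.
row_entry; case: eqP => [<-|_]; last by rewrite /=; ring.
by rewrite prednK ?odd_gt0 //=; ring.
Qed.

Lemma row_T3_odd j : (j <= d)%N -> odd j -> r j *m T ix3 = k3^-1 *: r j.
Proof.
move=> jd jo; apply: eq_mx_Ov => l ld; rewrite -mulmxA -!scalemxAl !row_Ov //.
case: (boolP (odd l)) => lo.
  rewrite OT3_odd // !mulmxDr -!scalemxAr !row_Ov //.
  have -> : (j == l.-1) = false by nlia.
  have -> : (j == l.+1) = false by nlia.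
  by row_entry; rewrite /=; ring.
rewrite OT3_even // -!scalemxAr !row_Ov //.
have -> : (j == l) = false by nlia.
by row_entry; rewrite /=; ring.
Qed.

Local Notation g j :=
  ((1 - k2 ^- 2 * (Q / q ^+ j)^-1) * (1 - (Q / q ^+ j)^-1)).

Lemma row_Ov_succ j l : ~~ odd j -> (l <= d)%N ->
  r j.+1 *m v l = (j.+1 == l)%:R%:M.
Proof.
move=> je ld; have [jd1|dj] := leqP j.+1 d; first by rewrite row_Ov.
rewrite row_Ov_out //; have -> : (j.+1 == l) = false by nlia.
by rewrite raddf0.
Qed.

Lemma row_T3_even j : (0 < j <= d)%N -> ~~ odd j -> r j *m T ix3 =
  k3 *: r j + k3 *: r j.-1 - (k3^-1 * g j.+1) *: r j.+1.
Proof.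
move=> /andP[j0 jd] je; have j1d : (j.-1 <= d)%N by nlia.
apply: eq_mx_Ov => l ld; rewrite -mulmxA mulmxBl mulmxDl -!scalemxAl.
rewrite row_Ov_succ // !row_Ov //.
case: (boolP (odd l)) => lo.
  rewrite OT3_odd // !mulmxDr -!scalemxAr !row_Ov //.
  have -> : (j == l) = false by nlia.
  have -> : (j == l.-1) = (j.+1 == l) by nlia.
  have -> : (j == l.+1) = (j.-1 == l) by nlia.
  by row_entry; case: (eqVneq j.+1 l) => [<-|_] /=; ring.
rewrite OT3_even // -!scalemxAr !row_Ov //.
have -> : (j.+1 == l) = false by nlia.
have -> : (j.-1 == l) = false by nlia.
by row_entry; rewrite /=; ring.
Qed.

Lemma row_T3_0 : r 0 *m T ix3 = k3 *: r 0 - (k3^-1 * g 1) *: r 1.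
Proof.
apply: eq_mx_Ov => l ld; rewrite -mulmxA mulmxBl -!scalemxAl.
rewrite row_Ov_succ // !row_Ov //.
case: (boolP (odd l)) => lo.
  rewrite OT3_odd // !mulmxDr -!scalemxAr !row_Ov //.
  have -> : (0%N == l) = false by nlia.
  have -> : (0%N == l.-1) = (1%N == l) by nlia.
  have -> : (0%N == l.+1) = false by nlia.
  by row_entry; case: (eqVneq 1%N l) => [<-|_] /=; ring.
rewrite OT3_even // -!scalemxAr !row_Ov //.
have -> : (1%N == l) = false by nlia.
by row_entry; rewrite /=; ring.
Qed.

Lemma Ov_expand (x : 'cV[F]_d.+1) : x = \sum_(j < d.+1) x j 0 *: v j.
Proof.
apply/matrixP=> i c; rewrite ord1 summxE (bigD1 i) //= !mxE eqxx mulr1.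
rewrite big1 ?addr0 // => j; rewrite !mxE eq_sym -(inj_eq val_inj) /= => /negPf ->.
by rewrite mulr0.
Qed.

Lemma row_coord (x : 'cV[F]_d.+1) (j : 'I_d.+1) : (r j *m x) 0 0 = x j 0.
Proof.
rewrite !mxE (bigD1 j) //= !mxE eqxx mul1r big1 ?addr0 // => i.
by rewrite !mxE -(inj_eq val_inj) /= => /negPf ->; rewrite mul0r.
Qed.

(** The coefficient of v_{j+1} in t_0 v_j, j odd, or t_1 v_j, j even, never
    vanishes for j < d. *)
Lemma Ogen_generated S : subrep T S -> S (v 0) -> forall x, S x.
Proof.
move=> sS S0; have Sv j : (j <= d)%N -> S (v j.-1) /\ S (v j).
  elim: j => [//|j IH] jd; have [Sp Sj] := IH (ltnW jd); split=> //.
  have lin := subrepP sS.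
  have sN a u : S u -> S (a *: u) by move=> Su; apply: subrepZ sS Su.
  case: (boolP (odd j)) => jo.
    have -> : v j.+1 = - (k0 * q ^+ j.+1) *: (T ix0 *m v j) + v j.
      have qn : q ^+ j.+1 != 0 by rewrite expf_neq0.
      by rewrite OT0_odd ?(ltnW jd) //; mx_field.
    by apply: (lin) => //; apply: subrep_act sS _ _ Sj.
  have -> : v j.+1 = k1 *: (T ix1 *m v j) + (- k1 ^+ 2 *: v j +
     (k1 ^+ 2 * (1 - q ^+ j) * (1 - k0 ^+ 2 * q ^+ j)) *: v j.-1).
    by rewrite OT1_even ?(ltnW jd) //; mx_field.
  apply: (lin); first by apply: subrep_act sS _ _ Sj.
  by apply: (lin) => //; apply: sN.
move=> x; rewrite (Ov_expand x); apply: (subrep_sum _ sS) => i _.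
by apply: subrepZ sS _; have [] := Sv i (leq_ord i).
Qed.

(** Dually, the rows of t_0 and t_2 express the coordinate of index j - 1 of x
    through coordinates of index j of x and of t_0 x or t_2 x. *)
Lemma Ogen_cogenerated S : subrep T S -> (forall x, S x -> r d *m x = 0) ->
  forall x, S x -> x = 0.
Proof.
move=> sS Sd; have Sj h : (h <= d)%N -> forall x, S x -> r (d - h) *m x = 0.
  elim: h => [_|h IH hd x Sx]; first by rewrite subn0.
  have {}IH := IH (ltnW hd); set j := (d - h)%N in IH.
  have jd : (0 < j <= d)%N by nlia.
  have -> : (d - h.+1)%N = j.-1 by nlia.
  have qj : k0^-1 * q ^- j != 0 by rewrite mulf_neq0 ?invr_neq0 ?expf_neq0.
  have Qj : k2 * (Q / q ^+ j) != 0.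
    by rewrite !mulf_neq0 ?invr_neq0 ?expf_neq0.
  case: (boolP (odd j)) => jo.
    have := IH _ (subrep_act sS ix2 Sx); rewrite mulmxA row_T2_odd //; last by nlia.
    rewrite mulmxDl -!scalemxAl (IH _ Sx) scaler0 addr0 => /eqP.
    by rewrite scaler_eq0 oppr_eq0 (negPf Qj) => /eqP.
  have := IH _ (subrep_act sS ix0 Sx); rewrite mulmxA row_T0_even //.
  rewrite mulmxDl -!scalemxAl (IH _ Sx) scaler0 addr0 => /eqP.
  by rewrite scaler_eq0 oppr_eq0 (negPf qj) => /eqP.
move=> x Sx; apply/matrixP=> i c; rewrite ord1 -row_coord.
have id : (i <= d)%N by rewrite leq_ord.
by rewrite -(subKn id) Sj ?leq_subr // !mxE.
Qed.

Section Simplicity.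
Hypothesis q_not_root : forall n, (0 < n)%N -> q ^+ n != 1.
Hypothesis kG : forall i, generic_at q d (tnth k i).

Lemma eigenvalue_quadratic n (c l : F) (A : 'M[F]_n) (x : 'rV[F]_n) :
  quadratic c A -> x != 0 -> x *m A = l *: x -> l != 0 /\ l + l^-1 = c.
Proof.
move=> qA x0 xA; have : (l * l - c * l + 1) *: x = 0.
  have : x *m A *m A = c *: (x *m A) - x.
    by rewrite -mulmxA qA mulmxBr mulmx1 scalemxAr.
  rewrite xA -scalemxAl xA => E.
  by rewrite scalerDl scalerBl -!scalerA scale1r E addrAC subrK subrr.
move/eqP; rewrite scaler_eq0 (negPf x0) orbF => /eqP E.
have l0 : l != 0.
  by apply: contra_eq_neq E => ->; rewrite !mulr0 subr0 add0r oner_neq0.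
split=> //; apply: (linear_combination (c := l^-1) E).
by field.
Qed.

Lemma quadratic_tr n (c : F) (A : 'M[F]_n) : quadratic c A -> quadratic c A^T.
Proof.
by rewrite /quadratic -trmx_mul => ->; rewrite linearB linearZ /= trmx1.
Qed.

Lemma Ogen_right_eigenvector (x : 'cV[F]_d.+1) l0 l3 : x != 0 ->
  T ix0 *m x = l0 *: x -> T ix3 *m x = l3 *: x -> x = x 0 0 *: v 0.
Proof.
move=> x0 T0x T3x; have [qT _] := Ogen_daha_mx.
have [l00 l0c] : l0 != 0 /\ l0 + l0^-1 = k0 + k0^-1.
  apply: (@eigenvalue_quadratic _ _ _ (T ix0)^T x^T).
  - exact/quadratic_tr/qT.
  - by rewrite -(inj_eq trmx_inj) trmxK trmx0.
  - by rewrite -trmx_mul T0x linearZ.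
have l0E := eq_or_inv (kn0 ix0) l00 l0c.
pose co (y : 'rV[F]_d.+1) := (y *m x) 0 0.
have coD y z : co (y + z) = co y + co z by rewrite /co mulmxDl mxE.
have coZ c y : co (c *: y) = c * co y by rewrite /co -scalemxAl mxE.
have coB y z : co (y - z) = co y - co z.
  by rewrite coD -scaleN1r coZ mulN1r.
have coT i l y : T i *m x = l *: x -> l * co y = co (y *m T i).
  by move=> Tx; rewrite /co -mulmxA Tx -scalemxAr [RHS]mxE.
have a0 j : (0 < j)%N -> co (r j) = 0.
  apply: (@right_eigen_eq0 _ q d q0 q_not_root d_even k0 k2 k3 l0 l3
    (fun j => co (r j))) => //=.
  - by move=> i di; rewrite /co Ov_out // trmx0 mul0mx mxE.
  - by rewrite (coT ix0) // row_T0_0 coZ.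
  - by move=> i di ie; rewrite (coT ix0) // row_T0_even // coD !coZ.
  - by move=> i di io; rewrite (coT ix0) // row_T0_odd // coZ coD coZ.
  - by move=> i di io; rewrite (coT ix3) // row_T3_odd // coZ.
  - by move=> i di ie; rewrite (coT ix3) // row_T3_even // coB coD !coZ.
  - by rewrite (coT ix3) // row_T3_0 coB !coZ.
apply/matrixP=> i c; rewrite ord1 !mxE.
have [->|i0] := eqVneq i 0; first by rewrite mulr1.
have := a0 i; rewrite /co row_coord lt0n => -> //.
by rewrite -[_ == 0%N :> nat]/(i == 0) (negPf i0) mulr0.
Qed.

Lemma Ogen_left_eigenvector (f : 'rV[F]_d.+1) l1 l2 : f != 0 ->
  f *m T ix1 = l1 *: f -> f *m T ix2 = l2 *: f ->
  exists2 c, c != 0 & f = c *: r d.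
Proof.
move=> f0 fT1 fT2; have [qT _] := Ogen_daha_mx.
have [l10 l1c] := eigenvalue_quadratic (qT ix1) f0 fT1.
have [l20 l2c] := eigenvalue_quadratic (qT ix2) f0 fT2.
pose co (y : 'cV[F]_d.+1) := (f *m y) 0 0.
have coD y z : co (y + z) = co y + co z by rewrite /co mulmxDr mxE.
have coZ c y : co (c *: y) = c * co y by rewrite /co -scalemxAr mxE.
have coB y z : co (y - z) = co y - co z.
  by rewrite coD -scaleN1r coZ mulN1r.
have coT i l y : f *m T i = l *: f -> l * co y = co (T i *m y).
  by move=> Tx; rewrite /co mulmxA Tx -scalemxAl [RHS]mxE.
have a0 j : (j < d)%N -> co (v j) = 0.
  apply: (@left_eigen_eq0 _ q d q0 q_not_root d_even k0 k1 k2 l1 l2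
    (fun j => co (v j))) => //=.
  - exact: eq_or_inv.
  - exact: eq_or_inv.
  - by move=> i di; rewrite /co Ov_out // mulmx0 mxE.
  - by move=> i di ie; rewrite (coT ix1) // OT1_even // !coD !coZ.
  - by move=> i di ie; rewrite (coT ix2) // OT2_even // coZ coB.
have coE (j : 'I_d.+1) : co (v j) = f 0 j.
  rewrite /co !mxE (bigD1 j) //= !mxE eqxx mulr1 big1 ?addr0 // => i.
  by rewrite !mxE -(inj_eq val_inj) /= => /negPf ->; rewrite mulr0.
have fE : f = f 0 ord_max *: r d.
  apply/matrixP=> c j; rewrite ord1 !mxE.
  have [->|jd] := eqVneq j ord_max; first by rewrite eqxx mulr1.
  have jd' : (j < d)%N.
    by rewrite ltn_neqAle -[_ == d]/(j == ord_max) jd leq_ord.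
  by rewrite -coE a0 // ltn_eqF // mulr0.
exists (f 0 ord_max) => //; apply: contraNneq f0 => f00.
by rewrite fE f00 scale0r.
Qed.

(** The dimension d + 1 is odd, so either S or its annihilator N has odd
    dimension. In the first case S contains a common eigenvector of t_0 and t_3,
    that is v_0, which generates. In the second case N contains a common left
    eigenvector of t_1 and t_2, that is the last coordinate form, and S = 0. *)
Lemma Ogen_simple : simple_rep T.
Proof.
move=> S sS; have [M MP] := subspace_mx (subrep0 sS) (subrepP sS).
have [qT _] := Ogen_daha_mx.
have MT i : (M *m (T i)^T <= M)%MS.
  apply/row_subP=> j; rewrite row_mul.
  have Sj : S (row j M)^T by apply/MP; rewrite trmxK row_sub.
  by move/MP: (subrep_act sS i Sj); rewrite trmx_mul trmxK.
have [oddM|evenM] := boolP (odd (\rank M)).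
  right; have [x [x0 xM [l0 xT0] [l3 xT3]]] := odd_common_eigenvector
    (kn0 ix0) (kn0 ix3) (quadratic_tr (qT ix0)) (quadratic_tr (qT ix3))
    (MT ix0) (MT ix3) oddM.
  have Tx i l : x *m (T i)^T = l *: x -> T i *m x^T = l *: x^T.
    by move=> xT; rewrite -[T i]trmxK -trmx_mul xT linearZ.
  have xt0 : x^T != 0 by rewrite -(inj_eq trmx_inj) trmxK trmx0.
  have xE := Ogen_right_eigenvector xt0 (Tx _ _ xT0) (Tx _ _ xT3).
  apply: (Ogen_generated sS).
  have c0 : x^T 0 0 != 0 by apply: contraNneq xt0 => c0; rewrite xE c0 scale0r.
  rewrite -(scalerK c0 (v 0)) -xE; apply: (subrepZ _ sS).
  by apply/MP; rewrite trmxK.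
left; pose N := kermx M^T.
have NT i : (N *m T i <= N)%MS.
  apply/sub_kermxP; rewrite -mulmxA -[T i]trmxK -trmx_mul.
  have /submxP[D ->] := MT i.
  by rewrite trmx_mul mulmxA mulmx_ker mul0mx.
have oddN : odd (\rank N).
  by rewrite mxrank_ker mxrank_tr oddB ?rank_leq_row //= d_even (negPf evenM).
have [f [f0 fN [l1 fT1] [l2 fT2]]] := odd_common_eigenvector
  (kn0 ix1) (kn0 ix2) (qT ix1) (qT ix2) (NT ix1) (NT ix2) oddN.
have [c c0 fE] := Ogen_left_eigenvector f0 fT1 fT2.
apply: (Ogen_cogenerated sS) => x /MP/submxP[u xu].
have fx : f *m x = 0.
  have /submxP[w ->] := fN; rewrite -[x]trmxK xu trmx_mul -mulmxA.
  by rewrite [N *m _]mulmxA mulmx_ker mul0mx mulmx0.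
by move: fx; rewrite fE -scalemxAl => /(canRL (scalerK c0)); rewrite scaler0.
Qed.
End Simplicity.

Lemma sum_pairs (c : F) (D : nat -> F) h :
  (forall i, (i < h)%N -> D i.*2 + D i.*2.+1 = c) ->
  \sum_(j < h.*2) D j = c *+ h.
Proof.
elim: h => [|h IH] Dc; first by rewrite big_ord0.
rewrite doubleS !big_ord_recr /= IH => [|i ih]; last by rewrite Dc // ltnW.
by rewrite -addrA Dc // mulrSr.
Qed.

(** The diagonal entries of index other than 0 (for t_0) or d (for t_1, t_2,
    t_3) add up in pairs to k_i + k_i^-1. Hence the k_i, and not only the k_i +
    k_i^-1, are invariants of the module. *)
Lemma Ogen_trace i :
  \tr (T i) = tnth k i + (tnth k i + (tnth k i)^-1) *+ d./2.
Proof.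
pose D j := (r j *m (T i *m v j)) 0 0.
have -> : \tr (T i) = \sum_(j < (d./2).*2.+1) D j.
  rewrite even_halfK //; apply: eq_bigr => j _.
  rewrite /D row_coord !mxE (bigD1 j) //= !mxE eqxx mulr1.
  rewrite big1 ?addr0 // => l.
  by rewrite !mxE -(inj_eq val_inj) /= => /negPf ->; rewrite mulr0.
have rr j l : (j <= d)%N -> (r j *m v l) 0 0 = (j == l)%:R.
  by move=> jd; rewrite row_Ov // !mxE eqxx mulr1n.
have rD j x y : (r j *m (x + y)) 0 0 = (r j *m x) 0 0 + (r j *m y) 0 0.
  by rewrite mulmxDr mxE.
have rZ j c x : (r j *m (c *: x)) 0 0 = c * (r j *m x) 0 0.
  by rewrite -scalemxAr mxE.
have rB j x y : (r j *m (x - y)) 0 0 = (r j *m x) 0 0 - (r j *m y) 0 0.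
  by rewrite rD -scaleN1r rZ mulN1r.
have dh := esym (even_halfK d_even).
have eS j : (j == j.+1) = false by nlia.
have eP j : (0 < j)%N -> (j == j.-1) = false by nlia.
have coefP' a b j : (a * (1 - q ^+ j) * b) * (j == j.-1)%:R = 0.
  case: j => [|j]; first by rewrite expr0 subrr mulr0 !mul0r.
  by rewrite eP // mulr0.
have split0 : D 0 + \sum_(j < (d./2).*2) D j.+1 =
    \sum_(j < (d./2).*2.+1) D j by rewrite big_ord_recl.
have D2 h (hd : (h < d./2)%N) : (h.*2 <= d)%N /\ [/\ (h.*2.+1 <= d)%N,
    (h.*2.+2 <= d)%N, ~~ odd h.*2, odd h.*2.+1 & ~~ odd h.*2.+2].
  by rewrite /= odd_double; split=> //; [|split=> //]; nlia.
elim/ord4_ind: i @D split0 => D split0.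
- rewrite -split0 (@sum_pairs (k0 + k0^-1) (fun j => D j.+1)).
    by congr (_ + _); rewrite /D mulmxA row_T0_0 -scalemxAl mxE rr // mulr1.
  move=> h /D2[_ [h1 h2 _ o1 o2]]; rewrite /D OT0_odd // OT0_even //.
  rewrite rD !rZ rB !rr // !eqxx coefP' eS /=; ring.
- rewrite big_ord_recr /= (@sum_pairs (k1 + k1^-1) D).
    rewrite /D -dh OT1_even // !rD !rZ !rr // eqxx mulNr coefP' eS.
    by rewrite mulr1 mulr0 addr0 oppr0 add0r addrC.
  move=> h /D2[h0 [h1 _ o0 o1 _]]; rewrite /D (OT1_odd o1) // (OT1_even o0) //.
  rewrite !rD !rZ !rr // !eqxx mulNr coefP' eS /=; ring.
- rewrite big_ord_recr /= (@sum_pairs (k2 + k2^-1) D).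
    rewrite /D -dh OT2_even // rZ rB !rr // eqxx eS divff ?expf_neq0 //=.
    by rewrite subr0 !mulr1 addrC.
  move=> h /D2[h0 [h1 _ o0 o1 _]]; rewrite /D (OT2_odd o1) // (OT2_even o0) //.
  rewrite rD !rZ rB !rr // !eqxx eS eP //=; ring.
- rewrite big_ord_recr /= (@sum_pairs (k3 + k3^-1) D).
    by rewrite /D -dh OT3_even // rZ rr // eqxx mulr1 addrC.
  move=> h /D2[h0 [h1 _ o0 o1 _]]; rewrite /D (OT3_odd o1) // (OT3_even o0) //.
  rewrite !rD !rZ !rr // !eqxx eS eP //=; ring.
Qed.

End OMatrices.

(** * Simple representations of odd dimension *)

Section Classification.
Variables (F : closedFieldType) (q : F) (q0 : q != 0).
Hypothesis q_not_root : forall n, (0 < n)%N -> q ^+ n != 1.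
Variables (d : nat) (d_even : ~~ odd d).

Lemma quadratic_root (c : F) : exists2 a : F, a != 0 & c = a + a^-1.
Proof.
(* The coefficients of x ^ 2 = c x - 1. *)
have [x xE] := @solve_monicpoly F 2 (nth 0 [:: -1; c]) isT.
rewrite !big_ord_recl big_ord0 /= expr0 expr1 mulr1 addr0 in xE.
have x0 : x != 0.
  apply/eqP=> x0; move: xE; rewrite x0 expr0n mulr0 addr0 => /esym/eqP.
  by rewrite oppr_eq0 oner_eq0.
exists x => //; apply: (linear_combination (c := - x^-1) xE).
by rewrite /bump /=; field.
Qed.

(** A common eigenvector x of t_0 and t_3 starts a Verma sequence v_j, and a
    common left eigenvector f of t_1 and t_2 tells which parameters k1, k2 to
    choose. The v_j span the representation, so f(v_e) <> 0 for some e; then e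
    is even and k0 k1 k2 k3 = q^-(e+1), which makes the span of the v_j with j >
    e a subrepresentation. It is killed by f, hence zero. Thus v_0, ..., v_e
    span an image of the O module of dimension e + 1; the map is injective
    because f restricts to a multiple of the last coordinate form, so e = d. *)
Lemma simple_rep_intertwiner c (T : 'I_4 -> 'M[F]_d.+1) :
  daha_mx q c T -> simple_rep T -> exists (k : 4.-tuple F) (P : 'M[F]_d.+1),
  [/\ forall i, tnth k i != 0, \prod_(i < 4) tnth k i = q ^- d.+1,
      P \in unitmx, forall i, T i *m P = P *m Ogen q d k i
    & forall i, c i = tnth k i + (tnth k i)^-1] /\
  generic_at q d (tnth k ix0) /\ generic_at q d (tnth k ix2).
Proof.
case=> qT pT sT.
have stable i : ((1%:M : 'M[F]_d.+1) *m T i <= (1%:M : 'M[F]_d.+1))%MS.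
  exact: submx1.
have odd1 : odd (\rank (1%:M : 'M[F]_d.+1)) by rewrite mxrank1.
have [a0 a00 c0E] := quadratic_root (c ix0).
have [a1 a10 c1E] := quadratic_root (c ix1).
have [a2 a20 c2E] := quadratic_root (c ix2).
have [a3 a30 c3E] := quadratic_root (c ix3).
have [x [x0 _ [k0 xT0] [k3 xT3]]] : exists x : 'rV[F]_d.+1,
    [/\ x != 0, (x <= (1%:M : 'M[F]_d.+1))%MS,
        exists l, x *m (T ix0)^T = l *: x & exists l, x *m (T ix3)^T = l *: x].
  apply: (odd_common_eigenvector a00 a30) => //; try exact: submx1.
  - by rewrite -c0E; apply: quadratic_tr.
  - by rewrite -c3E; apply: quadratic_tr.
have [f [f0 _ [k1 fT1] [k2 fT2]]] : exists x : 'rV[F]_d.+1,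
    [/\ x != 0, (x <= (1%:M : 'M[F]_d.+1))%MS,
        exists l, x *m T ix1 = l *: x & exists l, x *m T ix2 = l *: x].
  apply: (odd_common_eigenvector a10 a20) => //; try exact: submx1.
  - by rewrite -c1E.
  - by rewrite -c2E.
have [k00 k0c] := eigenvalue_quadratic (quadratic_tr (qT ix0)) x0 xT0.
have [k30 k3c] := eigenvalue_quadratic (quadratic_tr (qT ix3)) x0 xT3.
have [k10 k1c] := eigenvalue_quadratic (qT ix1) f0 fT1.
have [k20 k2c] := eigenvalue_quadratic (qT ix2) f0 fT2.
pose k := [tuple k0; k1; k2; k3].
have kn0 i : tnth k i != 0 by elim/ord4_ind: i.
have kc i : c i = tnth k i + (tnth k i)^-1 by elim/ord4_ind: i.
have Tq : daha_mx q (fun i => tnth k i + (tnth k i)^-1) T.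
  by split=> // i; rewrite -kc.
have v00 : x^T != 0 by rewrite -(inj_eq trmx_inj) trmxK trmx0.
have Tv i l : x *m (T i)^T = l *: x -> T i *m x^T = l *: x^T.
  by move=> xT; rewrite -[T i]trmxK -trmx_mul xT linearZ.
have T0v : T ix0 *m x^T = tnth k ix0 *: x^T by apply: Tv.
have T3v : T ix3 *m x^T = tnth k ix3 *: x^T by apply: Tv.
pose v := verma_rep q T k x^T.
have v0E : v 0%N = x^T by [].
have tailP := verma_tail_subrep q0 kn0 Tq T0v T3v.
have fnz (G : 'cV[F]_d.+1 -> Prop) : (forall y, span_of G y) ->
    ~ (forall g, G g -> f *m g = 0).
  move=> sG fG; case/eqP: f0; apply/matrixP=> a b; rewrite ord1 mxE.
  have := span_of_ker fG (sG (delta_mx b 0)); rewrite -colE => /matrixP/(_ 0 0).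
  by rewrite !mxE.
have [e fe] : exists e, f *m v e != 0.
  have tail0 : subrep T (span_of (verma_tail q T k x^T 0)).
    by apply: tailP => // _; rewrite expr0 subrr mul0r.
  have [z|all0] := sT _ tail0.
    case/eqP: v00; apply/z/span_of_gen; by exists 0%N.
  apply: contrapT => none; apply: (fnz _ all0) => _ [j _ ->].
  by apply/eqP/negPn/negP => fj; apply: none; exists j.
have LV := left_verma_even q0 kn0 Tq T0v T3v (fT1 : f *m T ix1 = tnth k ix1 *: f)
  (fT2 : f *m T ix2 = tnth k ix2 *: f).
have [e_even QE] := LV _ fe.
have qinj i j : q ^+ i = q ^+ j -> i = j.
  wlog ij : i j / (i <= j)%N.
    move=> H E; case: (leqP i j) => [ij|/ltnW ji]; first exact: H.
    exact/esym/H.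
  move=> E; apply/eqP; rewrite eqn_leq ij leqNgt; apply/negP => ij'.
  have : q ^+ (j - i) != 1 by rewrite q_not_root // subn_gt0.
  by case/eqP; rewrite expfB // E divff ?expf_neq0.
have vz j : (e < j)%N -> v j = 0.
  have tailS : subrep T (span_of (verma_tail q T k x^T e.+1)).
    by apply: tailP; rewrite /= e_even // => _; rewrite QE divff ?subrr ?mulr0 ?expf_neq0.
  have [z ej|alle] := sT _ tailS; first by apply/z/span_of_gen; exists j.
  case: (fnz _ alle) => _ [i ei ->]; apply/eqP/negPn/negP => fi.
  have [_] := LV _ fi; rewrite QE => /qinj[ie].
  by rewrite ie ltnn in ei.
have kPe : \prod_(i < 4) tnth k i = q ^- e.+1.
  rewrite -QE invrK !big_ord_recl big_ord0 mulr1 !mulrA.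
  by congr (_ * _ * _ * _); congr (tnth k _); apply/val_inj.
pose P := verma_mx q T k x^T e.
have TP : forall i, T i *m P = P *m Ogen q e k i.
  by apply: verma_mx_intertwines => //; apply: vz.
have PO j : (j <= e.+1)%N -> P *m Ov F e j = v j.
  by apply: mul_verma_mx; apply: vz.
have Pinj (y : 'cV[F]_e.+1) : P *m y = 0 -> y = 0.
  apply: (Ogen_cogenerated q0 e_even kn0 (S := fun y => P *m y = 0)).
    split=> [|a u w Pu Pw|i u Pu]; first by rewrite mulmx0.
      by rewrite mulmxDr -scalemxAr Pu Pw scaler0 addr0.
    by rewrite mulmxA -TP -mulmxA Pu mulmx0.
  move=> u Pu; pose s := (f *m v e) 0 0.
  have s0 : s != 0.
    apply: contraNneq fe => s0; apply/eqP/matrixP=> a b.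
    by rewrite !ord1 -/s s0 mxE.
  have fP : f *m P = s *: (Ov F e e)^T.
    apply: eq_mx_Ov => j je; rewrite -mulmxA PO ?leqW // -scalemxAl row_Ov //.
    have [<-|ej] := eqVneq e j.
      by rewrite [LHS]mx11_scalar scale_scalar_mx mulr1.
    rewrite scale_scalar_mx mulr0 raddf0; apply/eqP/negPn/negP => fj.
    by have [_] := LV _ fj; rewrite QE => /qinj[ej']; rewrite ej' eqxx in ej.
  apply: (scalerI s0); rewrite scaler0 scalemxAl -fP -mulmxA Pu mulmx0 //.
have ed : e = d.
  apply: succn_inj; apply/eqP; rewrite eqn_leq; apply/andP; split.
    have : row_free P^T.
      rewrite -kermx_eq0; apply/rowV0P=> u /sub_kermxP uP.
      by apply: trmx_inj; rewrite trmx0; apply: Pinj; rewrite -[P]trmxK -trmx_mul uP trmx0.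
    by move/eqP <-; apply: rank_leq_col.
  have : row_full P^T.
    rewrite -sub1mx; apply/row_subP => i.
    have imS : subrep T (fun y => exists u, y = P *m u).
      split=> [|a _ _ [u ->] [w ->]|l _ [u ->]]; first by exists 0; rewrite mulmx0.
        by exists (a *: u + w); rewrite mulmxDr scalemxAr.
      by exists (Ogen q e k l *m u); rewrite !mulmxA TP.
    have [z|im] := sT _ imS.
      case/eqP: v00; apply: z; exists (Ov F e 0); by rewrite PO.
    have [u uE] := im (row i 1%:M)^T.
    by rewrite -[row i _]trmxK uE trmx_mul submxMl.
  by move/eqP <-; apply: rank_leq_row.
move: {QE} (QE) kPe P TP PO Pinj vz e_even; rewrite {fe}ed {e ed}.
move=> QE kPd P TP PO Pinj vz _.
have Pu : P \in unitmx.
  rewrite -unitmx_tr -row_free_unit -kermx_eq0; apply/rowV0P=> u /sub_kermxP uP.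
  by apply: trmx_inj; rewrite trmx0; apply: Pinj; rewrite -[P]trmxK -trmx_mul uP trmx0.
exists k, P; split; first by split.
(* Such a tail contains v_b <> 0 but not v_0. *)
have no_tail b : (0 < b <= d)%N -> ~ subrep T (span_of (verma_tail q T k x^T b)).
  move=> /andP[b0 bd] tS; have [z|all] := sT _ tS.
    have : v b = 0 by apply/z/span_of_gen; exists b.
    rewrite -PO ?leqW // => /Pinj/matrixP/(_ (Ordinal (bd : (b < d.+1)%N)) 0).
    by rewrite !mxE eqxx => /eqP; rewrite oner_eq0.
  have := span_of_ker (f := (Ov F d 0)^T *m invmx P) _ (all (P *m Ov F d 0)).
  rewrite mulmxA mulmxKV // row_Ov // => H.
  have /matrixP/(_ 0 0) : (0%N == 0%N)%:R%:M = 0 :> 'M[F]_1.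
    apply: H => _ [j bj ->]; rewrite -/(v j); have [jd|dj] := leqP j d; last by rewrite vz ?mulmx0.
    rewrite -PO ?leqW // mulmxA mulmxKV // row_Ov //.
    by case: j bj {jd} => [|j]; [case: (b) b0 | rewrite raddf0].
  by rewrite !mxE eqxx => /eqP; rewrite oner_eq0.
split=> i id ie; apply/eqP => kE.
- apply: (no_tail i); first by case/andP: id => /ltnW -> ->.
  apply: tailP => [_|]; last by rewrite (negPf ie).
  by rewrite kE mulVf ?subrr ?mulr0 // expf_neq0.
- have bd : (0 < d.+1 - i <= d)%N by clear -id; lia.
  have bo : odd (d.+1 - i) by clear -id ie d_even; lia.
  apply: (no_tail _ bd); apply: tailP => [|_]; first by rewrite bo.
  rewrite QE expf_ratio ?leq_subr // subKn; last by case/andP: id => _ /leqW.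
  by rewrite kE invrK divff ?subrr ?mul0r // expf_neq0.
Qed.

Lemma intertwiner_trace c (T : 'I_4 -> 'M[F]_d.+1) (k : 4.-tuple F) P :
  (forall i, tnth k i != 0) ->
  P \in unitmx -> (forall i, T i *m P = P *m Ogen q d k i) ->
  (forall i, c i = tnth k i + (tnth k i)^-1) ->
  forall i, tnth k i = \tr (T i) - c i *+ d./2.
Proof.
move=> kn0 Pu TP cE i; have -> : T i = P *m Ogen q d k i *m invmx P.
  by rewrite -TP mulmxK.
by rewrite mxtrace_mulC mulKmx // Ogen_trace // cE addrK.
Qed.

(** A product equal to a scalar can be rotated. *)
Lemma daha_mx_rotate c (T : 'I_4 -> 'M[F]_d.+1) :
  daha_mx q c T -> daha_mx q (c \o @ordS 4) (T \o @ordS 4).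
Proof.
case=> qT pT; split=> [i|]; first exact: qT.
have o (i j : 'I_4) : ordS i = j :> nat -> T (ordS i) = T j.
  by move=> ij; congr (T _); apply: val_inj.
rewrite /= (o ix0 ix1) // (o ix1 ix2) // (o ix2 ix3) // (o ix3 ix0) //.
have : T ix0 *m (q *: (T ix1 *m T ix2 *m T ix3)) = 1%:M.
  by rewrite -scalemxAr !mulmxA pT -mul_scalar_mx -scalar_mxM divff.
move/mulmx1C; rewrite -scalemxAl => /(canRL (scalerK q0)) ->.
by rewrite scalemx1.
Qed.

Lemma simple_rep_rotate (T : 'I_4 -> 'M[F]_d.+1) :
  simple_rep T -> simple_rep (T \o @ordS 4).
Proof.
move=> sT S [S0 SP ST]; apply: sT; split=> // i u Su.
by rewrite -(ord_predK i); apply: ST.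
Qed.

(** The conditions on k1 and k3 are those on k0 and k2 for the rotated
    representation; the traces show that its parameters are the rotated ones. *)
Theorem simple_rep_classification c (T : 'I_4 -> 'M[F]_d.+1) :
  daha_mx q c T -> simple_rep T -> exists (k : 4.-tuple F) (P : 'M[F]_d.+1),
  [/\ forall i, tnth k i != 0, \prod_(i < 4) tnth k i = q ^- d.+1,
      P \in unitmx, forall i, T i *m P = P *m Ogen q d k i
    & forall i, generic_at q d (tnth k i)].
Proof.
move=> dT sT.
have [k [P [[kn0 kP Pu TP ck] [g0 g2]]]] := simple_rep_intertwiner dT sT.
have [k' [P' [[kn0' _ Pu' TP' ck'] [g1 g3]]]] :=
  simple_rep_intertwiner (daha_mx_rotate dT) (simple_rep_rotate sT).
have kk (i j : 'I_4) : ordS i = j :> nat -> tnth k' i = tnth k j.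
  move=> ij; have {ij}<- : ordS i = j by apply: val_inj.
  by rewrite (intertwiner_trace kn0' Pu' TP' ck') (intertwiner_trace kn0 Pu TP ck).
exists k, P; split=> //; elim/ord4_ind => //.
- by rewrite -(kk ix0).
- by rewrite -(kk ix2).
Qed.

End Classification.

(** * Modules over the algebra *)

Lemma linear_mx (F : fieldType) m n (phi : 'cV[F]_n -> 'cV[F]_m) :
  (forall a u w, phi (a *: u + w) = a *: phi u + phi w) ->
  exists M : 'M[F]_(m, n), forall u, phi u = M *m u.
Proof.
move=> phiP; have phi0 : phi 0 = 0.
  by have := phiP (-1) 0 0; rewrite scaler0 addr0 scaleN1r addNr.
have phiZ a u : phi (a *: u) = a *: phi u.
  by rewrite -[a *: u]addr0 phiP phi0 addr0.
have phiD u w : phi (u + w) = phi u + phi w.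
  by rewrite -[u in LHS]scale1r phiP scale1r.
exists (\matrix_(i, j) phi (delta_mx j 0) i 0) => u.
have {1}-> : u = \sum_j u j 0 *: delta_mx j 0.
  by rewrite {1}(matrix_sum_delta u); apply: eq_bigr => j _; rewrite big_ord1.
rewrite (big_morph phi phiD phi0); apply/matrixP=> i c.
rewrite ord1 summxE mxE; apply: eq_bigr => j _.
by rewrite phiZ !mxE mulrC.
Qed.

Lemma closed_eigenvector (F : closedFieldType) n (A : 'M[F]_n.+1) :
  exists (l : F) (x : 'cV[F]_n.+1), x != 0 /\ A *m x = l *: x.
Proof.
have /closed_rootP[l] : size (char_poly A^T) != 1%N by rewrite size_char_poly.
rewrite -eigenvalue_root_char => /eigenvalueP[x xA x0].
exists l, x^T; split; first by rewrite -(inj_eq trmx_inj) trmxK trmx0.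
by rewrite -[A]trmxK -trmx_mul xA linearZ.
Qed.

Section DahaModules.
Variables (F : fieldType) (q : F) (q0 : q != 0).
Local Notation H := (daha q0).
Local Notation gen := (daha_gen q0).
Local Notation inv := (daha_inv q0).

Lemma daha_gen_ind (P : H -> Prop) :
  (forall a : F, P a%:A) -> (forall i, P (gen i)) -> (forall i, P (inv i)) ->
  (forall x y, P x -> P y -> P (x + y)) ->
  (forall x y, P x -> P y -> P (x * y)) -> forall h, P h.
Proof.
move=> Pa Pg Pi PD PM; elim/daha_ind => x.
elim: x => [a|i|i|x IHx y IHy|x IHx y IHy].
- by rewrite daha_scalE.
- exact: Pg.
- exact: Pi.
- by rewrite -daha_piD; apply: PD.
- by rewrite -daha_piM; apply: PM.
Qed.

Lemma mulr_algl_comm (a : F) (h : H) : a%:A * h = h * a%:A.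
Proof. by rewrite -scalerAl -scalerAr mul1r mulr1. Qed.

Lemma daha_gen_central i (h : H) : (gen i + inv i) * h = h * (gen i + inv i).
Proof.
have [gV Vg gC _] := daha_gen_rel q0; set z := gen i + inv i.
elim/daha_gen_ind: h => [a|j|j|x y Px Py|x y Px Py].
- by rewrite mulr_algl_comm.
- exact: gC.
- by rewrite -[LHS]mul1r -(Vg j) -mulrA (mulrA (gen j)) -gC -(mulrA _ (gen j)) gV mulr1.
- by rewrite mulrDr [RHS]mulrDl Px Py.
- by rewrite mulrA Px -mulrA Py mulrA.
Qed.

(** A map commuting with t_i commutes with its two-sided inverse. *)
Lemma linear_of_gen (V W : lmodType H) (f : V -> W) :
  (forall a u w, f (a%:A *: u + w) = a%:A *: f u + f w) ->
  (forall i u, f (gen i *: u) = gen i *: f u) -> linear f.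
Proof.
have [gV Vg _ _] := daha_gen_rel q0 => fL fG.
have fD u w : f (u + w) = f u + f w.
  by have := fL 1 u w; rewrite !scale1r.
have f0 : f 0 = 0 by have /eqP := fD 0 0; rewrite addr0 -subr_eq subrr => /eqP.
have fZ (h : H) u : f (h *: u) = h *: f u.
  elim/daha_gen_ind: h u => [a|i|i|x y Px Py|x y Px Py] u.
  - by have := fL a u 0; rewrite f0 !addr0.
  - exact: fG.
  - rewrite -[LHS]scale1r -(Vg i) -scalerA -fG scalerA gV scale1r //.
  - by rewrite !scalerDl fD Px Py.
  - by rewrite -!scalerA Px Py.
by move=> h u w; rewrite fD fZ.
Qed.

Lemma mod_iso_of_linear (V W : lmodType H) (f : V -> W) :
  linear f -> bijective f -> mod_iso V W.
Proof.
move=> fL fB; pose L := GRing.isLinear.Build _ V W *:%R f fL.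
by pose f' : {linear V -> W} := HB.pack f L; exists f'.
Qed.

Lemma mod_iso_refl (V : lmodType H) : mod_iso V V.
Proof. by apply: (@mod_iso_of_linear V V id) => //; exists id. Qed.

Lemma mod_iso_sym (V W : lmodType H) : mod_iso V W -> mod_iso W V.
Proof.
case=> f [g fK gK]; apply: (@mod_iso_of_linear W V g); last by exists f.
by move=> h u w; apply: (can_inj fK); rewrite linearP !gK.
Qed.

Lemma mod_iso_trans (V W U : lmodType H) :
  mod_iso V W -> mod_iso W U -> mod_iso V U.
Proof.
case=> f fB [g gB]; apply: (@mod_iso_of_linear V U (g \o f)).
  by move=> h u w /=; rewrite !linearP.
exact: bij_comp.
Qed.

Lemma iso_classP (V W : lmodType H) : iso_class V = iso_class W <-> mod_iso V W.
Proof.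
split=> [E|VW].
  by have : iso_class W W := mod_iso_refl W; rewrite -E.
apply/funext=> U; apply/propext; split; last exact: mod_iso_trans.
by apply: mod_iso_trans; apply: mod_iso_sym.
Qed.

End DahaModules.

Section IrreducibleModules.
Variables (F : closedFieldType) (q : F) (q0 : q != 0) (d : nat).
Local Notation H := (daha q0).
Local Notation gen := (daha_gen q0).
Local Notation inv := (daha_inv q0).

Record coordinates (V : lmodType H) (ff : V -> 'cV[F]_d.+1) : Prop :=
  Coordinates {
    coord_bij : bijective ff;
    coord_lin : forall a u w, ff (a%:A *: u + w) = a *: ff u + ff w }.

Lemma has_dim_coordinates (V : lmodType H) :
  has_dim V d.+1 -> exists ff : V -> 'cV[F]_d.+1, coordinates ff.
Proof.
case=> f fL [g fK gK]; exists (fun u => (f u)^T); split.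
  by exists (fun x => g x^T) => x; rewrite ?trmxK ?fK ?gK ?trmxK.
move=> a u w; rewrite -linearZ -linearD /=; congr (_^T).
exact: (fL a u w).
Qed.

(** Schur: t_i + t_i^-1 is central, so the eigenspace of one of its eigenvalues
    is a nonzero submodule, hence all of V. *)
Lemma irreducible_coordinates (V : lmodType H) (ff : V -> 'cV[F]_d.+1) :
  irreducible_mod V -> coordinates ff ->
  exists (c : 'I_4 -> F) (T : 'I_4 -> 'M[F]_d.+1),
    [/\ forall i u, ff (gen i *: u) = T i *m ff u, daha_mx q c T
      & simple_rep T].
Proof.
move=> [_ irrV] [[gg ffK ggK] fL].
have [gV Vg gC gP] := daha_gen_rel q0.
have f0 : ff 0 = 0 by have := fL (-1) 0 0; rewrite scaler0 addr0 scaleN1r addNr.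
have fZ a u : ff (a%:A *: u) = a *: ff u by rewrite -[_ *: u]addr0 fL f0 addr0.
have fD u w : ff (u + w) = ff u + ff w.
  by have := fL 1 u w; rewrite !scale1r.
have fB u w : ff (u - w) = ff u - ff w.
  by have := fL (-1) w u; rewrite !scaleN1r [X in ff X]addrC [RHS]addrC.
have ginj := can_inj ffK.
have [act actE] : exists act : H -> 'M[F]_d.+1, forall h u, ff (h *: u) = act h *m ff u.
  have actx h : exists M : 'M[F]_d.+1, forall x, ff (h *: gg x) = M *m x.
    apply: linear_mx => a u w.
    have -> : gg (a *: u + w) = a%:A *: gg u + gg w.
      by apply: ginj; rewrite fL !ggK.
    by rewrite scalerDr !scalerA -mulr_algl_comm -scalerA fL.
  have [act actE] := choice actx.
  by exists act => h u; rewrite -{1}(ffK u) actE.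
have act_eq (A B : 'M[F]_d.+1) : (forall u, A *m ff u = B *m ff u) -> A = B.
  move=> AB; apply/matrixP=> i j; have := AB (gg (delta_mx j 0)).
  by rewrite ggK -!colE => /matrixP/(_ i 0); rewrite !mxE.
have schur i : exists c : F, forall u : V, (gen i + inv i) *: u = c%:A *: u.
  have [c [x [x0 zx]]] := closed_eigenvector (act (gen i + inv i)).
  exists c => u; pose S := [pred u : V | (gen i + inv i) *: u == c%:A *: u].
  have SP : GRing.submod_closed S.
    split; first by rewrite inE !scaler0.
    move=> h v w; rewrite !inE => /eqP vE /eqP wE.
    rewrite !scalerDr wE !scalerA daha_gen_central -scalerA vE scalerA.
    by rewrite mulr_algl_comm.
  have Sx : gg x \in S.
    by rewrite inE; apply/eqP/ginj; rewrite actE fZ ggK.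
  case: (irrV S SP) => SE; last by have := SE u; rewrite !inE => /eqP.
  move: Sx; rewrite SE inE => /eqP gx; case/eqP: x0.
  by rewrite -(ggK x) gx f0.
have [c cE] := choice schur.
have invE i (u : V) : inv i *: u = (c i)%:A *: u - gen i *: u.
  by rewrite -(cE i u) scalerDl addrAC subrr add0r.
exists c, (fun i => act (gen i)); split=> //.
- split=> [i|].
    apply: act_eq => u; rewrite mulmxBl -scalemxAl mul1mx -mulmxA -!actE.
    rewrite -fZ -fB; congr ff; have := invE i (gen i *: u).
    by rewrite scalerA Vg scale1r => uE; rewrite {3}uE subKr.
  apply: act_eq => u; rewrite -!mulmxA -!actE mul_scalar_mx -fZ; congr ff.
  by rewrite !scalerA -gP.
- move=> S [S0 SP ST].
  have SA h u : S (ff u) -> S (ff (h *: u)).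
    have SZ a x : S x -> S (a *: x) by move=> Sx; rewrite -[_ *: _]addr0; apply: SP.
    have Sg i x : S (ff x) -> S (ff (gen i *: x)) by rewrite actE; apply: ST.
    elim/daha_gen_ind: h u => [a|i|i|x y Px Py|x y Px Py] u Su.
    - by rewrite fZ; apply: SZ.
    - exact: Sg.
    - rewrite invE -scaleN1r addrC; have := fL (-1) (gen i *: u) ((c i)%:A *: u).
      rewrite scaleN1r => ->; rewrite fZ.
      by apply: SP; [apply: Sg | apply: SZ].
    - by rewrite scalerDl fD -[ff (x *: _)]scale1r; apply: SP; [apply: Px | apply: Py].
    - by rewrite -scalerA; apply/Px/Py.
  have [|SE|SE] := irrV [pred u : V | `[<S (ff u)>]].
  + split; first by apply/asboolP; rewrite f0.
    move=> h u w /asboolP Su /asboolP Sw; apply/asboolP.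
    by rewrite fD -[ff (h *: _)]scale1r; apply: SP => //; apply: SA.
  + left=> x Sx; have := SE (gg x); rewrite !inE ggK => E.
    have /eqP gx : gg x == 0 by rewrite -E; apply/asboolP.
    by rewrite -(ggK x) gx.
  + by right=> x; have := SE (gg x); rewrite !inE ggK => /asboolP.
Qed.
End IrreducibleModules.

Section OModules.
Variables (F : closedFieldType) (q : F) (q0 : q != 0).
Variables (d : nat) (d_even : ~~ odd d).
Local Notation H := (daha q0).
Local Notation gen := (daha_gen q0).
Local Notation Om := (Omod q0 d_even).
Implicit Types k : Oparam q d.

Lemma Omod_scal k a (u : Om k) : a%:A *: u = a *: (u : 'cV[F]_d.+1).
Proof.
rewrite -daha_scalE -[LHS]/(rep_scale _ _) /rep_scale.
rewrite (daha_lift_pi q0 (O_rel q0 d_even k)) /=.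
by rewrite scalemx1 mul_scalar_mx.
Qed.

Lemma Omod_gen k i (u : Om k) :
  gen i *: u = Ogen q d (val k) i *m (u : 'cV[F]_d.+1) :> 'cV[F]_d.+1.
Proof. exact: rep_genE. Qed.

Lemma Omod_has_dim k : has_dim (Om k) d.+1.
Proof.
exists (fun u => (u : 'cV[F]_d.+1)^T).
  move=> a u w; rewrite -linearZ -linearD /=; congr (_^T).
  by rewrite -[a *: u]/((a%:A : H) *: (u : Om k)) Omod_scal.
by exists (fun x : 'rV[F]_d.+1 => x^T : Om k) => x; rewrite trmxK.
Qed.

Lemma Oparam_neq0 k i : tnth (val k) i != 0.
Proof. by have /andP[/forallP] := valP k. Qed.
Lemma Oparam_prod k : \prod_(i < 4) tnth (val k) i = q ^- d.+1.
Proof. by have /andP[_ /eqP] := valP k. Qed.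

Lemma Omod_intertwiner k k' : mod_iso (Om k) (Om k') ->
  exists2 P : 'M[F]_d.+1, P \in unitmx &
    forall i, Ogen q d (val k') i *m P = P *m Ogen q d (val k) i.
Proof.
case=> f [g fK gK].
have mxP k1 k2 (h : {linear Om k1 -> Om k2}) :
    exists M : 'M[F]_d.+1, forall u : 'cV[F]_d.+1, (h u : 'cV[F]_d.+1) = M *m u.
  by apply: linear_mx => a u w; rewrite -(Omod_scal (k := k1)) linearP Omod_scal.
have [P PE] := mxP _ _ f.
exists P.
  rewrite -unitmx_tr -row_free_unit -kermx_eq0; apply/rowV0P=> u /sub_kermxP uP.
  apply: trmx_inj; rewrite trmx0; apply: (can_inj fK).
  by rewrite linear0 PE -[P]trmxK -trmx_mul uP trmx0.
move=> i; apply: (@eq_mx_Ov F d) => j jd; rewrite -!mulmxA -!PE.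
by rewrite -(Omod_gen (k := k)) -(Omod_gen (k := k')) linearZ.
Qed.

(** A nonzero A with A ^ 2 = cA - 1 determines c. *)
Lemma quadratic_inj n (A : 'M[F]_n.+1) c c' :
  quadratic c A -> quadratic c' A -> c = c'.
Proof.
rewrite /quadratic => qA; rewrite qA => /addIr/eqP.
rewrite -subr_eq0 -scalerBl scaler_eq0 subr_eq0 => /orP[/eqP //|/eqP A0].
move: qA; rewrite A0 mul0mx scaler0 sub0r => /eqP; rewrite eq_sym oppr_eq0.
by rewrite oner_eq0.
Qed.

Lemma Omod_inj k k' : mod_iso (Om k) (Om k') -> k = k'.
Proof.
case/Omod_intertwiner => P Pu PT; apply/val_inj/eq_from_tnth => i.
have kn0 := Oparam_neq0 k; have kn0' := Oparam_neq0 k'.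
rewrite (intertwiner_trace q0 d_even kn0 Pu PT (fun=> erefl)).
have [qO _] := Ogen_daha_mx q0 d_even kn0 (Oparam_prod k).
have [qO' _] := Ogen_daha_mx q0 d_even kn0' (Oparam_prod k').
have -> : tnth (val k) i + (tnth (val k) i)^-1 =
    tnth (val k') i + (tnth (val k') i)^-1.
  apply: quadratic_inj (qO' i); apply: (can_inj (mulmxK Pu)).
  rewrite -mulmxA PT mulmxA PT -mulmxA qO mulmxBr mulmxBl mulmx1 mul1mx.
  by rewrite -scalemxAr -scalemxAl PT.
by rewrite Ogen_trace // addrK.
Qed.

Hypothesis q_not_root : forall n, (0 < n)%N -> q ^+ n != 1.

Lemma Omod_irreducible k : (forall i, generic_at q d (tnth (val k) i)) ->
  irreducible_mod (Om k).
Proof.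
move=> kG; split.
  exists (Ov F d 0 : 'cV[F]_d.+1); apply/eqP => /matrixP/(_ 0 0).
  by rewrite !mxE eqxx => /eqP; rewrite oner_eq0.
move=> S [S0 SP].
have sS : subrep (Ogen q d (val k)) (fun u => (u : Om k) \in S).
  split=> // [a u w Su Sw|i u Su].
    by rewrite -(Omod_scal (k := k)); apply: SP.
  by rewrite -(Omod_gen (k := k)) -[_ *: _]addr0; apply: SP.
case: (Ogen_simple q0 d_even (Oparam_neq0 k) (Oparam_prod k) q_not_root kG sS).
  move=> z; left=> u; rewrite inE; apply/idP/eqP => [/z //|->]; exact: S0.
by move=> all; right=> u; rewrite all.
Qed.

Lemma irreducible_Omod (V : lmodType H) : irreducible_mod V -> has_dim V d.+1 ->
  exists2 k, forall i, generic_at q d (tnth (val k) i) & mod_iso (Om k) V.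
Proof.
move=> irrV /has_dim_coordinates[ff ffC].
have [c [T [ffT dT sT]]] := irreducible_coordinates irrV ffC.
have [k [P [kn0 kP Pu TP kG]]] :=
  simple_rep_classification q0 q_not_root d_even dT sT.
have kp : [forall i, tnth k i != 0] && (\prod_(i < 4) tnth k i == q ^- d.+1).
  by apply/andP; split; [apply/forallP | apply/eqP].
exists (exist _ k kp) => //; set K : Oparam q d := exist _ k kp.
case: ffC => [[gg ffK ggK] fL].
apply: (@mod_iso_of_linear _ _ _ (Om K) V (fun u => gg (P *m u))).
  apply: linear_of_gen => [a u w|i u]; apply: (can_inj ffK).
    by rewrite fL !ggK Omod_scal mulmxDr scalemxAr.
  by rewrite ffT !ggK Omod_gen !mulmxA TP.
exists (fun x => invmx P *m ff x) => u; first by rewrite ggK mulKmx.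
by rewrite mulKVmx // ffK.
Qed.

End OModules.

(** * The bijection *)

Theorem theorem2p6 (F : closedFieldType) (q : F) (q_neq0 : q != 0)
    (q_not_root : forall n : nat, (0 < n)%N -> q ^+ n != 1)
    (d : nat) (d_even : ~~ odd d) :
  exists O : OP q d -> OM q_neq0 d,
    bijective O /\
    forall k : OP q d, sval (O k) = iso_class (Omod q_neq0 d_even (sval k)).
Proof.
have OMk (k : OP q d) : exists V, [/\ irreducible_mod V, has_dim V d.+1
    & iso_class (Omod q_neq0 d_even (sval k)) = iso_class V].
  exists (Omod q_neq0 d_even (sval k)); split=> //.
    by apply: Omod_irreducible => // i j; apply: (svalP k).
  exact: Omod_has_dim.
pose O (k : OP q d) : OM q_neq0 d :=
  exist _ (iso_class (Omod q_neq0 d_even (sval k))) (OMk k).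
exists O; split=> //.
have Oinj : injective O.
  move=> [k kG] [k' kG'] /(congr1 sval)/= /iso_classP/Omod_inj kk.
  exact: eq_exist.
have Osurj (C : OM q_neq0 d) : exists k, O k = C.
  case: C => C CP; have [V [irrV dV CE]] := CP.
  have [k kG kV] := irreducible_Omod d_even q_not_root irrV dV.
  exists (exist _ k kG); apply: eq_exist => /=; rewrite CE.
  exact/iso_classP.
have [g gK] := choice Osurj.
by exists g => // k; apply: Oinj; rewrite gK.
Qed.
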